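(* The system $\mathsf P$ proves $\mathsf{NPC}^{\mathbb a}\leftrightarrow\Pi^0_1\text{-}\mathsf{TRANS}$.
   Context: Framework. $\mathsf{E\text{-}PA}^{\omega*}$ is Peano arithmetic in all finite types with the axiom of extensionality, with additional types $\rho^*$ of finite sequences; type $0$ = naturals, $1=0\to0$. The language of $\mathsf P$ adds a predicate $\mathrm{st}$ (''standard'') for every type; $(\forall^{\mathrm{st}}x)\varphi\equiv(\forall x)(\mathrm{st}(x)\to\varphi)$, $(\exists^{\mathrm{st}}x)\varphi\equiv(\exists x)(\mathrm{st}(x)\wedge\varphi)$; internal = not containing $\mathrm{st}$. $\mathsf P$ is $\mathsf{E\text{-}PA}^{\omega*}$ plus: (i) $\mathrm{st}(x)\wedge x=y\to\mathrm{st}(y)$; (ii) $\mathrm{st}(t)$ for each closed term $t$; (iii) $\mathrm{st}(f)\wedge\mathrm{st}(x)\to\mathrm{st}(f(x))$; (iv) external induction for every formula; (v) $\mathsf{HAC}_{\mathrm{int}}$: for internal $\varphi$, $(\forall^{\mathrm{st}}x^\rho)(\exists^{\mathrm{st}}y^\tau)\varphi(x,y)\to(\exists^{\mathrm{st}}F^{\rho\to\tau^*})(\forall^{\mathrm{st}}x^\rho)(\exists y\in F(x))\varphi(x,y)$; (vi) idealisation: for internal $\varphi$ with arbitrary parameters, $(\forall^{\mathrm{st}}x^{\sigma^*})(\exists y^\tau)(\forall z^\sigma\in x)\varphi(z,y)\to(\exists y^\tau)(\forall^{\mathrm{st}}x^\sigma)\varphi(x,y)$. $\alpha\approx_1\beta$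 means $(\forall^{\mathrm{st}}n)\alpha(n)=\beta(n)$. Finite sequences of numbers coded by numbers; $\overline\alpha k$ initial segment of length $k$; $\sigma\preceq\tau$ means $\sigma$ is an initial segment of $\tau$. Associates: $\gamma^1\in C$ means $(\forall\beta^1)(\exists k^0)\gamma(\overline\beta k)>0$ together with the neighbourhood-function condition $(\forall\sigma^0,\tau^0,n^0)\big((\sigma\preceq\tau\wedge\gamma(\overline\sigma n)>0)\to\gamma(\sigma)=\gamma(\tau)\big)$. The value $\gamma(\alpha)$ of $\gamma\in C$ at $\alpha^1$ is $\gamma(\overline\alpha N)-1$ for any $N$ with $\gamma(\overline\alpha N)>0$; $\gamma(\alpha)=m$ means $(\forall n)(\gamma(\overline\alpha n)>0\to\gamma(\overline\alpha n)=m+1)$, and $\gamma(\alpha)=\gamma(\beta)$ means that these values coincide. $\mathsf{NPC}^{\mathbb a}$: $(\forall^{\mathrm{st}}\gamma^1\in C,\alpha^1)(\forall\beta^1)(\alpha\approx_1\beta\to\gamma(\alpha)=_0\gamma(\beta))$. $\Pi^0_1\text{-}\mathsf{TRANS}$: $(\forall^{\mathrm{st}}f^1)\big[(\forall^{\mathrm{st}}n^0)f(n)=0\to(\forall m^0)f(m)=0\big]$. *)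

(* Defs.v *)
From Stdlib Require Import List.
Import ListNotations.

(** * Gödel's T with sequence types *)

Inductive ty : Set :=
| N : ty
| Arr : ty -> ty -> ty
| Seq : ty -> ty.

Declare Scope ty_scope.
Delimit Scope ty_scope with ty.
Bind Scope ty_scope with ty.
Notation "s ⇒ t" := (Arr s t) (at level 55, right associativity) : ty_scope.
Notation "s ^*" := (Seq s) (at level 30, format "s ^*") : ty_scope.

Definition ctx : Set := list ty.

(** Typed de Bruijn variables: [var G r] is a position of type [r] in [G]. *)
Inductive var : ctx -> ty -> Set :=
| vz : forall {G r}, var (r :: G) r
| vs : forall {G s r}, var G r -> var (s :: G) r.

Inductive cst : ty -> Set :=
| cO : cst N
| cS : cst (N ⇒ N)
| cPi : forall r s, cst (r ⇒ s ⇒ r)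
| cSigma : forall r s t, cst ((r ⇒ s ⇒ t) ⇒ (r ⇒ s) ⇒ r ⇒ t)
| cR : forall r, cst (N ⇒ r ⇒ (r ⇒ N ⇒ r) ⇒ r)
| cNil : forall s, cst (s^*)
| cCons : forall s, cst (s ⇒ s^* ⇒ s^*)
| cL : forall s r, cst (s^* ⇒ r ⇒ (r ⇒ s ⇒ r) ⇒ r).

Inductive tm (G : ctx) : ty -> Set :=
| Var : forall {r}, var G r -> tm G r
| Cst : forall {r}, cst r -> tm G r
| App : forall {s r}, tm G (s ⇒ r) -> tm G s -> tm G r.
Arguments Var {G r} _.
Arguments Cst {G r} _.
Arguments App {G s r} _ _.

Declare Scope tm_scope.
Delimit Scope tm_scope with tm.
Bind Scope tm_scope with tm.
Local Open Scope tm_scope.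
Notation "t · u" := (App t u) (at level 38, left associativity) : tm_scope.
Notation "#0" := (Var vz) : tm_scope.
Notation "#1" := (Var (vs vz)) : tm_scope.
Notation "#2" := (Var (vs (vs vz))) : tm_scope.
Notation "#3" := (Var (vs (vs (vs vz)))) : tm_scope.
Notation "#4" := (Var (vs (vs (vs (vs vz))))) : tm_scope.

Notation zero := (Cst cO).
Notation Suc t := (Cst cS · t).

Definition renaming (G D : ctx) : Set := forall r, var G r -> var D r.
Definition substitution (G D : ctx) : Set := forall r, var G r -> tm D r.

Definition shift {G s} : renaming G (s :: G) := fun r x => vs x.

Definition up_ren {G D} {s : ty} (f : renaming G D) : renaming (s :: G) (s :: D) :=
  fun r x =>
    match x in var G' r'
    return (match G' with
            | [] => unit
            | s' :: G'' => renaming G'' D -> var (s' :: D) r'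
            end)
    with
    | vz => fun _ => vz
    | vs y => fun g => vs (g _ y)
    end f.

Fixpoint ren_tm {G D} (f : renaming G D) {r} (t : tm G r) : tm D r :=
  match t with
  | Var x => Var (f _ x)
  | Cst c => Cst c
  | App t u => App (ren_tm f t) (ren_tm f u)
  end.

Notation wk t := (ren_tm shift t).

Definition scons {G D} {s : ty} (u : tm D s) (f : substitution G D) :
  substitution (s :: G) D :=
  fun r x =>
    match x in var G' r'
    return (match G' with
            | [] => unit
            | s' :: G'' => tm D s' -> substitution G'' D -> tm D r'
            end)
    with
    | vz => fun u _ => u
    | vs y => fun _ g => g _ y
    end u f.

Definition up_sub {G D} {s : ty} (f : substitution G D) :
  substitution (s :: G) (s :: D) :=
  scons #0 (fun r x => wk (f r x)).

Fixpoint sub_tm {G D} (f : substitution G D) {r} (t : tm G r) : tm D r :=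
  match t with
  | Var x => f _ x
  | Cst c => Cst c
  | App t u => App (sub_tm f t) (sub_tm f u)
  end.

(** Embedding of closed terms in an arbitrary context. *)
Definition closed_in {G r} (t : tm [] r) : tm G r :=
  ren_tm (fun r (x : var [] r) =>
            match x in var G' _ return match G' with [] => var G r | _ => unit end
            with vz => tt | vs _ => tt end) t.

(** Abstraction is not primitive: [lam] is bracket abstraction with respect to
    the innermost variable. A subterm without that variable, as recognised by
    [strengthen], is abstracted in one step by [cPi]. *)
Definition strengthen_var {G s r} (x : var (s :: G) r) : option (tm G r) :=
  match x in var G' r'
  return (match G' with [] => unit | _ :: G'' => option (tm G'' r') end)
  with
  | vz => None
  | vs y => Some (Var y)
  end.

Fixpoint strengthen {G s r} (t : tm (s :: G) r) : option (tm G r) :=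
  match t with
  | Var x => strengthen_var x
  | Cst c => Some (Cst c)
  | App t u =>
      match strengthen t, strengthen u with
      | Some t', Some u' => Some (App t' u')
      | _, _ => None
      end
  end.

Definition lam_var {G s r} (x : var (s :: G) r) : tm G (s ⇒ r) :=
  match x in var G' r'
  return (match G' with [] => unit | s' :: G'' => tm G'' (s' ⇒ r') end)
  with
  | @vz _ r => Cst (cSigma r (r ⇒ r) r) · Cst (cPi r (r ⇒ r)) · Cst (cPi r r)
  | vs y => Cst (cPi _ _) · Var y
  end.

Fixpoint lam {G s r} (t : tm (s :: G) r) : tm G (s ⇒ r) :=
  match t with
  | Var x => lam_var x
  | Cst c => Cst (cPi _ _) · Cst c
  | App t u =>
      match strengthen t, strengthen u with
      | Some t', Some u' => Cst (cPi _ _) · (t' · u')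
      | _, _ => Cst (cSigma _ _ _) · lam t · lam u
      end
  end.

Notation "'λ' t" := (lam t) (at level 60, right associativity) : tm_scope.
Notation Rec n a f := (Cst (cR _) · n · a · f).
Notation LRec s a f := (Cst (cL _ _) · s · a · f).

(** ** Elementary arithmetic *)

Definition cPlus {G} : tm G (N ⇒ N ⇒ N) :=
  λ λ Rec #0 #1 (λ λ Suc #1).
Definition cPred {G} : tm G (N ⇒ N) :=
  λ Rec #0 zero (λ λ #0).
Definition cMonus {G} : tm G (N ⇒ N ⇒ N) :=
  λ λ Rec #0 #1 (λ λ cPred · #1).
(** [cIfz · n · a · b] is [a] if [n = 0] and [b] otherwise. *)
Definition cIfz {G} : tm G (N ⇒ N ⇒ N ⇒ N) :=
  λ λ λ Rec #2 #1 (λ λ #2).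

Notation "t + u" := (cPlus · t · u) (at level 50, left associativity) : tm_scope.
Notation "t - u" := (cMonus · t · u) (at level 50, left associativity) : tm_scope.

(** ** Coding of finite sequences of numbers by numbers

    [<>] is coded by [0] and [s * <x>] by [S (pair s x)], where [pair] is the
    Cantor pairing [pair x y = tri (x + y) + y]; hence every number codes
    exactly one finite sequence. *)

Definition cTri {G} : tm G (N ⇒ N) :=
  λ Rec #0 zero (λ λ #1 + Suc #0).
Definition cPair {G} : tm G (N ⇒ N ⇒ N) :=
  λ λ (cTri · (#1 + #0)) + #0.
(** The largest [d] with [tri d <= n], i.e. [x + y] for [n = pair x y]. *)
Definition cDiag {G} : tm G (N ⇒ N) :=
  λ Rec #0 zero (λ λ cIfz · (cTri · Suc #1 - Suc #0) · Suc #1 · #1).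
(** The first projection of the pairing. *)
Definition cFst {G} : tm G (N ⇒ N) :=
  λ cDiag · #0 - (#0 - cTri · (cDiag · #0)).

(** Removes the last entry of a coded sequence; maps [<>] to [<>]. *)
Definition cInit {G} : tm G (N ⇒ N) :=
  λ cIfz · #0 · zero · (cFst · (cPred · #0)).
(** [cInits · n · s] removes the last [n] entries of [s]. *)
Definition cInits {G} : tm G (N ⇒ N ⇒ N) :=
  λ λ Rec #1 #0 (λ λ cInit · #1).
(** The number of [n < s] with [cInits · n · s <> <>]. *)
Definition cLh {G} : tm G (N ⇒ N) :=
  λ Rec #0 zero (λ λ cIfz · (cInits · #0 · #2) · #1 · Suc #1).

(** The initial segment of length [k] of [alpha : N ⇒ N]. *)
Definition cSeg {G} : tm G ((N ⇒ N) ⇒ N ⇒ N) :=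
  λ λ Rec #0 zero (λ λ Suc (cPair · #1 · (#3 · #0))).
(** The initial segment of length [n] of the sequence coded by [s], which is
    [s] itself if [n >= |s|]. *)
Definition cTake {G} : tm G (N ⇒ N ⇒ N) :=
  λ λ cInits · (cLh · #1 - #0) · #1.

Notation seg a k := (cSeg · a · k).
Notation take s n := (cTake · s · n).

(** ** Objects of sequence type *)

Fixpoint default {G} (r : ty) : tm G r :=
  match r with
  | N => zero
  | s ⇒ t => Cst (cPi _ _) · default t
  | s^* => Cst (cNil s)
  end%ty.

Definition cLen {G s} : tm G (s^* ⇒ N) :=
  λ LRec #0 zero (λ λ Suc #1).
(** The [i]-th entry, or [default s] if [i] is out of range. *)
Definition cNth {G s} : tm G (s^* ⇒ N ⇒ s) :=
  λ LRec #0 (Cst (cPi _ _) · default s) (λ λ λ Rec #0 #1 (λ λ #4 · #0)).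

(** * Formulas *)

Inductive fm : ctx -> Type :=
| Bot : forall {G}, fm G
| Eq0 : forall {G}, tm G N -> tm G N -> fm G
| St : forall {G r}, tm G r -> fm G
| Imp : forall {G}, fm G -> fm G -> fm G
| And : forall {G}, fm G -> fm G -> fm G
| Or : forall {G}, fm G -> fm G -> fm G
| All : forall {G} r, fm (r :: G) -> fm G
| Ex : forall {G} r, fm (r :: G) -> fm G.

Declare Scope fm_scope.
Delimit Scope fm_scope with fm.
Bind Scope fm_scope with fm.
Local Open Scope fm_scope.
Notation "t ≐ u" := (Eq0 t u) (at level 70) : fm_scope.
Notation "p ⊃ q" := (Imp p q) (at level 85, right associativity) : fm_scope.
Notation "p ∧ q" := (And p q) (at level 80, right associativity) : fm_scope.
Notation "p ∨ q" := (Or p q) (at level 82, right associativity) : fm_scope.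
Notation "'∀[' r ] p" := (All r p) (at level 86, r at level 60, right associativity) : fm_scope.
Notation "'∃[' r ] p" := (Ex r p) (at level 86, r at level 60, right associativity) : fm_scope.
Notation "'∀st[' r ] p" := (All r (Imp (St #0) p))
  (at level 86, r at level 60, right associativity) : fm_scope.
Notation "'∃st[' r ] p" := (Ex r (And (St #0) p))
  (at level 86, r at level 60, right associativity) : fm_scope.

Definition Iff {G} (p q : fm G) : fm G := (p ⊃ q) ∧ (q ⊃ p).

Fixpoint internal {G} (p : fm G) : Prop :=
  match p with
  | Bot => True
  | Eq0 _ _ => True
  | St _ => False
  | Imp p q | And p q | Or p q => internal p /\ internal q
  | All _ p | Ex _ p => internal p
  end.

Fixpoint ren_fm {G} (p : fm G) : forall {D}, renaming G D -> fm D :=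
  match p with
  | Bot => fun D f => Bot
  | Eq0 t u => fun D f => Eq0 (ren_tm f t) (ren_tm f u)
  | St t => fun D f => St (ren_tm f t)
  | Imp p q => fun D f => Imp (ren_fm p f) (ren_fm q f)
  | And p q => fun D f => And (ren_fm p f) (ren_fm q f)
  | Or p q => fun D f => Or (ren_fm p f) (ren_fm q f)
  | All r p => fun D f => All r (ren_fm p (up_ren f))
  | Ex r p => fun D f => Ex r (ren_fm p (up_ren f))
  end.

Fixpoint sub_fm {G} (p : fm G) : forall {D}, substitution G D -> fm D :=
  match p with
  | Bot => fun D f => Bot
  | Eq0 t u => fun D f => Eq0 (sub_tm f t) (sub_tm f u)
  | St t => fun D f => St (sub_tm f t)
  | Imp p q => fun D f => Imp (sub_fm p f) (sub_fm q f)
  | And p q => fun D f => And (sub_fm p f) (sub_fm q f)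
  | Or p q => fun D f => Or (sub_fm p f) (sub_fm q f)
  | All r p => fun D f => All r (sub_fm p (up_sub f))
  | Ex r p => fun D f => Ex r (sub_fm p (up_sub f))
  end.

Definition wk_fm {G s} (p : fm G) : fm (s :: G) := ren_fm p shift.
Definition inst {G s} (p : fm (s :: G)) (t : tm G s) : fm G :=
  sub_fm p (scons t (fun r x => Var x)).
(** [p(S n)], for [p(n)] with [n] the innermost variable. *)
Definition inst_suc {G} (p : fm (N :: G)) : fm (N :: G) :=
  sub_fm p (scons (Suc #0) (fun r x => Var (vs x))).
(** Makes room for a fresh variable below the two innermost ones. *)
Definition wk2_fm {G a b s} (p : fm (a :: b :: G)) : fm (a :: b :: s :: G) :=
  ren_fm p (up_ren (up_ren shift)).

Definition Lt {G} (t u : tm G N) : fm G := ∃[N] wk t + Suc #0 ≐ wk u.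
Notation "t ≺ u" := (Lt t u) (at level 70) : fm_scope.

(** Only equality of numbers is primitive; equality at higher types is
    extensional. *)
Fixpoint Eq {G} (r : ty) : tm G r -> tm G r -> fm G :=
  match r return tm G r -> tm G r -> fm G with
  | N => fun t u => t ≐ u
  | s ⇒ r => fun t u => ∀[s] Eq r (wk t · #0) (wk u · #0)
  | s^* => fun t u =>
      (cLen · t ≐ cLen · u) ∧
      ∀[N] (#0 ≺ cLen · wk t) ⊃ Eq s (cNth · wk t · #0) (cNth · wk u · #0)
  end%ty.
Arguments Eq {G r} _ _.
Notation "t ≡ u" := (Eq t u) (at level 70) : fm_scope.

Definition Mem {G s} (t : tm G s) (u : tm G (s^*)) : fm G :=
  ∃[N] (#0 ≺ cLen · wk u) ∧ (cNth · wk u · #0 ≡ wk t).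
Notation "t ∊ u" := (Mem t u) (at level 70) : fm_scope.

(** * Classical natural deduction over a set of axioms *)

Inductive nd (Ax : forall G, fm G -> Prop) : forall G, list (fm G) -> fm G -> Prop :=
| nd_ax G H p : Ax G p -> nd Ax G H p
| nd_hyp G H p : In p H -> nd Ax G H p
| nd_raa G H p : nd Ax G ((p ⊃ Bot) :: H) Bot -> nd Ax G H p
| nd_impI G H p q : nd Ax G (p :: H) q -> nd Ax G H (p ⊃ q)
| nd_impE G H p q : nd Ax G H (p ⊃ q) -> nd Ax G H p -> nd Ax G H q
| nd_andI G H p q : nd Ax G H p -> nd Ax G H q -> nd Ax G H (p ∧ q)
| nd_andE1 G H p q : nd Ax G H (p ∧ q) -> nd Ax G H p
| nd_andE2 G H p q : nd Ax G H (p ∧ q) -> nd Ax G H q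
| nd_orI1 G H p q : nd Ax G H p -> nd Ax G H (p ∨ q)
| nd_orI2 G H p q : nd Ax G H q -> nd Ax G H (p ∨ q)
| nd_orE G H p q c :
    nd Ax G H (p ∨ q) -> nd Ax G (p :: H) c -> nd Ax G (q :: H) c -> nd Ax G H c
| nd_allI G H r p : nd Ax (r :: G) (map wk_fm H) p -> nd Ax G H (∀[r] p)
| nd_allE G H r p t : nd Ax G H (∀[r] p) -> nd Ax G H (inst p t)
| nd_exI G H r p t : nd Ax G H (inst p t) -> nd Ax G H (∃[r] p)
| nd_exE G H r p c :
    nd Ax G H (∃[r] p) -> nd Ax (r :: G) (p :: map wk_fm H) (wk_fm c) -> nd Ax G H c.

(** * The systems *)

Inductive EPA_ax : forall G, fm G -> Prop :=
| ax_refl G (t : tm G N) : EPA_ax G (t ≐ t)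
| ax_sym G (t u : tm G N) : EPA_ax G (t ≐ u ⊃ u ≐ t)
| ax_trans G (t u v : tm G N) : EPA_ax G (t ≐ u ⊃ u ≐ v ⊃ t ≐ v)
| ax_ext G r s (f : tm G (r ⇒ s)) (t u : tm G r) : EPA_ax G (t ≡ u ⊃ f · t ≡ f · u)
| ax_Suc_neq G (t : tm G N) : EPA_ax G (Suc t ≐ zero ⊃ Bot)
| ax_Suc_inj G (t u : tm G N) : EPA_ax G (Suc t ≐ Suc u ⊃ t ≐ u)
| ax_Pi G r s (t : tm G r) (u : tm G s) : EPA_ax G (Cst (cPi r s) · t · u ≡ t)
| ax_Sigma G r s v (f : tm G (r ⇒ s ⇒ v)) (g : tm G (r ⇒ s)) (t : tm G r) :
    EPA_ax G (Cst (cSigma r s v) · f · g · t ≡ f · t · (g · t))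
| ax_R0 G r (a : tm G r) (f : tm G (r ⇒ N ⇒ r)) : EPA_ax G (Rec zero a f ≡ a)
| ax_RS G r (n : tm G N) (a : tm G r) (f : tm G (r ⇒ N ⇒ r)) :
    EPA_ax G (Rec (Suc n) a f ≡ f · Rec n a f · n)
| ax_L0 G s r (a : tm G r) (f : tm G (r ⇒ s ⇒ r)) :
    EPA_ax G (LRec (Cst (cNil s)) a f ≡ a)
| ax_LC G s r (x : tm G s) (l : tm G (s^*)) (a : tm G r) (f : tm G (r ⇒ s ⇒ r)) :
    EPA_ax G (LRec (Cst (cCons s) · x · l) a f ≡ f · LRec l a f · x)
| ax_seq G s (l : tm G (s^*)) :
    EPA_ax G ((l ≡ Cst (cNil s)) ∨
              ∃[s] ∃[s^*] wk (wk l) ≡ Cst (cCons s) · #1 · #0)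
| ax_ind G (p : fm (N :: G)) : internal p ->
    EPA_ax G (inst p zero ∧ (∀[N] p ⊃ inst_suc p) ⊃ ∀[N] p).

(** In the schemata below [p] may contain parameters from [G]. *)
Inductive P_ax : forall G, fm G -> Prop :=
| ax_EPA G p : EPA_ax G p -> P_ax G p
| ax_st_eq G r (t u : tm G r) : P_ax G (St t ∧ t ≡ u ⊃ St u)
| ax_st_closed G r (t : tm [] r) : P_ax G (St (closed_in t))
| ax_st_app G r s (f : tm G (r ⇒ s)) (t : tm G r) : P_ax G (St f ∧ St t ⊃ St (f · t))
| ax_ext_ind G (p : fm (N :: G)) :
    P_ax G (inst p zero ∧ (∀st[N] p ⊃ inst_suc p) ⊃ ∀st[N] p)
| ax_HAC_int G r s (p : fm (s :: r :: G)) : internal p ->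
    P_ax G ((∀st[r] ∃st[s] p) ⊃
            ∃st[r ⇒ s^*] ∀st[r] ∃[s] (#0 ∊ #2 · #1) ∧ wk2_fm p)
| ax_idealisation G s r (p : fm (s :: r :: G)) : internal p ->
    P_ax G ((∀st[s^*] ∃[r] ∀[s] (#0 ∊ #2) ⊃ wk2_fm p) ⊃
            ∃[r] ∀st[s] p).

Definition P_proves (p : fm []) : Prop := nd P_ax [] [] p.

(** * The principles *)

(** [s] is an initial segment of [t]. *)
Definition Prefix {G} (s t : tm G N) : fm G := ∃[N] wk s ≐ take (wk t) #0.

Definition Approx1 {G} (a b : tm G (N ⇒ N)) : fm G :=
  ∀st[N] wk a · #0 ≐ wk b · #0.

Definition InC {G} (g : tm G (N ⇒ N)) : fm G :=
  (∀[N ⇒ N] ∃[N] zero ≺ wk (wk g) · seg #1 #0) ∧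
  (∀[N] ∀[N] ∀[N]
     (* σ = #2, τ = #1, n = #0 *)
     (Prefix #2 #1 ∧ zero ≺ wk (wk (wk g)) · take #2 #0) ⊃
     wk (wk (wk g)) · #2 ≐ wk (wk (wk g)) · #1).

(** The value of the associate [g] at [a] is [m]. *)
Definition ValueIs {G} (g a : tm G (N ⇒ N)) (m : tm G N) : fm G :=
  ∀[N] (zero ≺ wk g · seg (wk a) #0) ⊃ wk g · seg (wk a) #0 ≐ Suc (wk m).

Definition SameValue {G} (g a b : tm G (N ⇒ N)) : fm G :=
  ∃[N] ValueIs (wk g) (wk a) #0 ∧ ValueIs (wk g) (wk b) #0.

Definition NPCa : fm [] :=
  ∀st[N ⇒ N] InC #0 ⊃
  ∀st[N ⇒ N] ∀[N ⇒ N] (* γ = #2, α = #1, β = #0 *)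
    Approx1 #1 #0 ⊃ SameValue #2 #1 #0.

Definition Pi01_TRANS : fm [] :=
  ∀st[N ⇒ N] (∀st[N] #1 · #0 ≐ zero) ⊃ (∀[N] #1 · #0 ≐ zero).

(* Main.v *)
(** [TRANS -> NPC]: for standard [γ] and [α] the function [n ↦ γ(ᾱn)] is standard and
    not identically zero, so transfer yields a standard [k] with [γ(ᾱk) > 0]. If [α ≈ β]
    then [ᾱk = β̄k] by external induction, hence [γ] has the same value at [α] and [β].

    [NPC -> TRANS]: let the standard [f] vanish at all standard numbers, but [f m <> 0].
    Let [μ] be the least number with [f μ <> 0]. The associate that waits until the length
    of its argument [σ] reaches [μ] and then returns the code of the initial segment of [σ]
    of length [μ] is definable from [f], hence standard. It takes different values at the
    zero function and at [n ↦ f (S n)], which agree at all standard numbers.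

    Derivations are handled in natural deduction: [E H t u] (provable equality under the hypotheses
    [H]) is a congruence available for rewriting, and case distinctions are stated as rules
    quantifying over all extensions [H'] of [H]. *)

From Stdlib Require Import List Setoid Morphisms.
Import ListNotations.
Require Import Defs.
Local Open Scope tm_scope.
Local Open Scope fm_scope.

(** * Substitution *)

(** The nonempty context is an index of [var], so the match inspects it in its return type instead
    of using dependent inversion. Quantifying [P] over all types lets the rule be applied after
    [revert r x]. *)
Lemma var_cons_case {G s} (P : forall r, var (s :: G) r -> Prop) :
  P s vz -> (forall r y, P r (vs y)) -> forall r x, P r x.
Proof.
  intros h0 h1 r x.
  refine (match x as x' in var G' r' return
            (match G' return var G' r' -> Prop with
             | [] => fun _ => True
             | s' :: G'' => fun x' => forall P : forall r, var (s' :: G'') r -> Prop,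
                 P s' vz -> (forall r y, P r (vs y)) -> P r' x'
             end x') with vz => _ | vs y => _ end P h0 h1); auto.
Qed.

Lemma ren_ren_tm {G D K r} (f : renaming G D) (g : renaming D K) (t : tm G r) :
  ren_tm g (ren_tm f t) = ren_tm (fun r x => g r (f r x)) t.
Proof. induction t; cbn; congruence. Qed.

Lemma ren_tm_ext {G D r} (f g : renaming G D) (t : tm G r) :
  (forall r x, f r x = g r x) -> ren_tm f t = ren_tm g t.
Proof. intros e; induction t; cbn; congruence. Qed.

Lemma sub_tm_ext {G D r} (f g : substitution G D) (t : tm G r) :
  (forall r x, f r x = g r x) -> sub_tm f t = sub_tm g t.
Proof. intros e; induction t; cbn; congruence. Qed.

Lemma sub_ren_tm {G D K r} (f : renaming G D) (g : substitution D K) (t : tm G r) :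
  sub_tm g (ren_tm f t) = sub_tm (fun r x => g r (f r x)) t.
Proof. induction t; cbn; congruence. Qed.

Lemma ren_sub_tm {G D K r} (f : substitution G D) (g : renaming D K) (t : tm G r) :
  ren_tm g (sub_tm f t) = sub_tm (fun r x => ren_tm g (f r x)) t.
Proof. induction t; cbn; congruence. Qed.

Lemma ren_up_wk {G D s r} (f : renaming G D) (t : tm G r) :
  ren_tm (@up_ren _ _ s f) (wk t) = wk (ren_tm f t).
Proof. rewrite !ren_ren_tm. now apply ren_tm_ext. Qed.

Lemma sub_up_wk {G D s r} (f : substitution G D) (t : tm G r) :
  sub_tm (@up_sub _ _ s f) (wk t) = wk (sub_tm f t).
Proof. rewrite sub_ren_tm, ren_sub_tm. now apply sub_tm_ext. Qed.

Lemma sub_scons_wk {G D s r} (u : tm D s) (f : substitution G D) (t : tm G r) :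
  sub_tm (scons u f) (wk t) = sub_tm f t.
Proof. rewrite sub_ren_tm. now apply sub_tm_ext. Qed.

Lemma sub_tm_Var {G r} (t : tm G r) : sub_tm (fun _ x => Var x) t = t.
Proof. induction t; cbn; congruence. Qed.

Lemma sub_tm_Var_vs {G s r} (t : tm G r) :
  sub_tm (fun _ x => Var (@vs _ s _ x)) t = wk t.
Proof. induction t; cbn; try congruence. reflexivity. Qed.

Lemma sub_scons_up {G D s r} (u : tm D s) (f : substitution G D) (t : tm (s :: G) r) :
  sub_tm (scons u (fun _ x => Var x)) (sub_tm (up_sub f) t) = sub_tm (scons u f) t.
Proof.
  induction t as [r x|r c|]; cbn; try congruence.
  revert r x; apply var_cons_case; intros; cbn; auto.
  rewrite sub_scons_wk, sub_tm_Var. reflexivity.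
Qed.

Lemma strengthen_wk {G s r} (t : tm G r) : strengthen (@ren_tm _ _ (@shift G s) r t) = Some t.
Proof. induction t; cbn; auto. now rewrite IHt1, IHt2. Qed.

Lemma strengthen_some {G s r} (t : tm (s :: G) r) t' : strengthen t = Some t' -> t = wk t'.
Proof.
  revert t'; induction t as [r x|r c|q r t IHt u IHu]; cbn; intros t' e.
  - revert r x t' e. refine (var_cons_case _ _ _); cbn; intros; try discriminate.
    now injection e as <-.
  - now injection e as <-.
  - destruct (strengthen t), (strengthen u); try discriminate.
    injection e as <-; cbn; now rewrite <- IHt, <- IHu.
Qed.

(** Under [up_sub] the bound variable stays fixed and the images of the other variables are
    weakened, so its occurrences are neither created nor lost. This keeps the branching inside [lam]
    stable. *)
Lemma strengthen_sub {G D s r} (f : substitution G D) (t : tm (s :: G) r) :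
  strengthen (sub_tm (up_sub f) t) = option_map (sub_tm f) (strengthen t).
Proof.
  induction t as [r x|r c|q r t IHt u IHu]; cbn; auto.
  - revert r x. apply var_cons_case; cbn; auto; intros. apply strengthen_wk.
  - rewrite IHt, IHu. now destruct (strengthen t), (strengthen u).
Qed.

Lemma lam_wk {G s r} (t : tm G r) : lam (@ren_tm _ _ (@shift G s) r t) = Cst (cPi _ _) · t.
Proof. destruct t; cbn; auto. now rewrite !strengthen_wk. Qed.

(** A syntactic identity, thanks to the clause of [lam] that abstracts constant subterms in one
    step: a free variable replaced by a compound term still gives a single [cPi]. *)
Lemma sub_lam {G D s r} (f : substitution G D) (t : tm (s :: G) r) :
  sub_tm f (lam t) = lam (sub_tm (up_sub f) t).
Proof.
  induction t as [r x|r c|q r t IHt u IHu]; cbn; auto.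
  - revert r x. apply var_cons_case; cbn; auto; intros. now rewrite lam_wk.
  - rewrite !strengthen_sub.
    destruct (strengthen t), (strengthen u); cbn; congruence.
Qed.

Lemma ren_tm_sub {G D r} (f : renaming G D) (t : tm G r) :
  ren_tm f t = sub_tm (fun _ x => Var (f _ x)) t.
Proof. induction t; cbn; congruence. Qed.

Lemma ren_lam {G D s r} (f : renaming G D) (t : tm (s :: G) r) :
  ren_tm f (lam t) = lam (ren_tm (up_ren f) t).
Proof.
  rewrite !ren_tm_sub, sub_lam. f_equal. apply sub_tm_ext.
  apply var_cons_case; reflexivity.
Qed.

Lemma sub_default {G D r} (f : substitution G D) : sub_tm f (default r) = default r.
Proof. induction r; cbn; congruence. Qed.

Lemma ren_cLen {G D s} (f : renaming G D) : ren_tm f (@cLen G s) = cLen.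
Proof. reflexivity. Qed.
Lemma sub_cLen {G D s} (f : substitution G D) : sub_tm f (@cLen G s) = cLen.
Proof. reflexivity. Qed.
(** The term contains [default s], defined by recursion on [s], so computation alone does not
    suffice as it does for [cLen]. *)
Lemma sub_cNth {G D s} (f : substitution G D) : sub_tm f (@cNth G s) = cNth.
Proof.
  unfold cNth. repeat (rewrite sub_lam; cbn [sub_tm]). now rewrite sub_default.
Qed.
Lemma ren_cNth {G D s} (f : renaming G D) : ren_tm f (@cNth G s) = cNth.
Proof. now rewrite ren_tm_sub, sub_cNth. Qed.

Lemma ren_Eq {r G D} (f : renaming G D) (t u : tm G r) :
  ren_fm (t ≡ u) f = (ren_tm f t ≡ ren_tm f u).
Proof.
  revert G D f t u; induction r as [|a IHa b IHb|a IHa]; intros; cbn [Eq ren_fm ren_tm].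
  - reflexivity.
  - rewrite IHb. cbn [ren_tm]. rewrite !ren_up_wk. reflexivity.
  - rewrite IHa. unfold Lt. cbn [ren_fm ren_tm]. rewrite !ren_up_wk.
    rewrite ?ren_up_wk, ?ren_cLen, !ren_cNth.  reflexivity.
Qed.

Lemma sub_Eq {r G D} (f : substitution G D) (t u : tm G r) :
  sub_fm (t ≡ u) f = (sub_tm f t ≡ sub_tm f u).
Proof.
  revert G D f t u; induction r as [|a IHa b IHb|a IHa]; intros; cbn [Eq sub_fm sub_tm].
  - reflexivity.
  - rewrite IHb. cbn [sub_tm]. rewrite !sub_up_wk. reflexivity.
  - rewrite IHa. unfold Lt. cbn [sub_fm sub_tm]. rewrite !sub_up_wk.
    cbn [sub_tm]; rewrite ?sub_up_wk, ?sub_cLen, !sub_cNth.  reflexivity.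
Qed.

(** * Derivability and provable equality *)

Notation prv := (nd P_ax _).

Lemma nd_weaken {Ax G H H' p} : incl H H' -> nd Ax G H p -> nd Ax G H' p.
Proof.
  intros i d; revert H' i; induction d; intros H' i;
    solve [econstructor; eauto using incl_map, incl_cons, incl_tl, in_eq].
Qed.

Lemma prv_cut {G} {H : list (fm G)} {p q} : prv H p -> prv (p :: H) q -> prv H q.
Proof. intros a b. eapply nd_impE; [apply nd_impI, b | exact a]. Qed.

Lemma prv_mp {G} {H : list (fm G)} {p q} : prv H (p ⊃ q) -> prv H p -> prv H q.
Proof. apply nd_impE. Qed.
Lemma prv_and {G} {H : list (fm G)} {p q} : prv H p -> prv H q -> prv H (p ∧ q).
Proof. apply nd_andI. Qed.
Lemma prv_and1 {G} {H : list (fm G)} {p q} : prv H (p ∧ q) -> prv H p.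
Proof. apply nd_andE1. Qed.
Lemma prv_and2 {G} {H : list (fm G)} {p q} : prv H (p ∧ q) -> prv H q.
Proof. apply nd_andE2. Qed.
Lemma prv_inst {G} {H : list (fm G)} {r} {p : fm (r :: G)} t : prv H (∀[r] p) -> prv H (inst p t).
Proof. apply nd_allE. Qed.

Lemma prv_imp {G} {H : list (fm G)} {p q} :
  (forall H', incl H H' -> prv H' p -> prv H' q) -> prv H (p ⊃ q).
Proof.
  intros k. apply nd_impI, k; [apply incl_tl, incl_refl | apply nd_hyp, in_eq].
Qed.

Lemma prv_raa {G} {H : list (fm G)} {p} :
  (forall H', incl H H' -> prv H' (p ⊃ Bot) -> prv H' Bot) -> prv H p.
Proof.
  intros k. apply nd_raa, k; [apply incl_tl, incl_refl | apply nd_hyp, in_eq].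
Qed.

Lemma prv_bot {G} {H : list (fm G)} {p} : prv H Bot -> prv H p.
Proof. intros h. apply nd_raa. eapply nd_weaken; [|exact h]. apply incl_tl, incl_refl. Qed.

Lemma prv_or {G} {H : list (fm G)} {p q c} : prv H (p ∨ q) ->
  (forall H', incl H H' -> prv H' p -> prv H' c) ->
  (forall H', incl H H' -> prv H' q -> prv H' c) -> prv H c.
Proof.
  intros h k l. eapply nd_orE; [exact h| apply k | apply l];
    (apply incl_tl, incl_refl || apply nd_hyp, in_eq).
Qed.

(** The facts needed under a binder are carried along as a single formula [k]. *)
Lemma prv_all {G} {H : list (fm G)} {r} {p : fm (r :: G)} (k : fm G) : prv H k ->
  (forall H', prv H' (wk_fm k) -> prv H' p) -> prv H (∀[r] p).
Proof.
  intros a b. apply (prv_cut a), nd_allI, b, nd_hyp, in_eq.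
Qed.

Lemma prv_ex {G} {H : list (fm G)} {r} {p : fm (r :: G)} {c} (k : fm G) :
  prv H (∃[r] p) -> prv H k ->
  (forall H', prv H' (wk_fm k) -> prv H' p -> prv H' (wk_fm c)) -> prv H c.
Proof.
  intros a b d. apply (prv_cut b). eapply nd_exE.
  - eapply nd_weaken; [|exact a]. apply incl_tl, incl_refl.
  - apply d; apply nd_hyp; cbn; auto.
Qed.

Lemma prv_epa {G} {H : list (fm G)} {p} : EPA_ax G p -> prv H p.
Proof. intros; now apply nd_ax, ax_EPA. Qed.

Lemma prv_ind_with {G} {H : list (fm G)} (k : fm G) (p : fm (N :: G)) t : internal p ->
  prv H k -> prv H (inst p zero) ->
  (forall H', prv H' (wk_fm k) -> prv H' p -> prv H' (inst_suc p)) -> prv H (inst p t).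
Proof.
  intros i a z s. apply nd_allE. eapply nd_impE.
  - apply prv_epa, ax_ind, i.
  - apply nd_andI; [exact z|]. apply (prv_all k a). intros H' b.
    apply nd_impI, s; [|apply nd_hyp, in_eq].
    eapply nd_weaken; [|exact b]. apply incl_tl, incl_refl.
Qed.

Definition E {G} (H : list (fm G)) {r} (t u : tm G r) : Prop := prv H (t ≡ u).

Lemma E_intro {G} {H : list (fm G)} {t u : tm G N} : prv H (t ≐ u) -> E H t u.
Proof. auto. Qed.

Lemma E_weaken {G} {H H' : list (fm G)} {r} {t u : tm G r} : incl H H' -> E H t u -> E H' t u.
Proof. apply nd_weaken. Qed.

Lemma Eq_refl {r G} (H : list (fm G)) (t : tm G r) : prv H (t ≡ t).
Proof.
  revert G H t; induction r; intros; cbn [Eq].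
  - apply prv_epa, ax_refl.
  - apply nd_allI, IHr2.
  - apply nd_andI; [apply prv_epa, ax_refl|]. apply nd_allI, nd_impI, IHr.
Qed.

Ltac as_E := match goal with |- nd P_ax ?G ?H (?a ≐ ?b) => change (@E G H N a b) end.

(** Facts known under the smaller list of hypotheses are carried over to the extension, as when
    passing to a later world of a Kripke model. *)
Ltac lift i :=
  repeat match goal with
  | h : nd P_ax ?G ?H ?p |- _ =>
      match type of i with incl H _ => apply (nd_weaken i) in h end
  | h : @E ?G ?H _ _ _ |- _ =>
      match type of i with incl H _ => apply (E_weaken i) in h end
  end; try clear i.
Tactic Notation "world" ident(H) := intros H ?i; lift i.

(** * Normalising renamings and substitutions *)

Lemma inst_Eq {G s r} (t u : tm (s :: G) r) v :
  inst (t ≡ u) v = (sub_tm (scons v (fun _ x => Var x)) t ≡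
                    sub_tm (scons v (fun _ x => Var x)) u).
Proof. apply sub_Eq. Qed.

(** Closed terms exist here as families over all contexts. The class lets [sim] discard
    substitutions on them while their bodies are opaque. *)
Class closed_tm {r} (c : forall G, tm G r) : Prop := {
  closed_ren : forall G D (f : renaming G D), ren_tm f (c G) = c D;
  closed_sub : forall G D (f : substitution G D), sub_tm f (c G) = c D }.
#[local] Instance cPlus_closed : closed_tm (@cPlus).
Proof. split; reflexivity. Qed.
Lemma up_sub_vz {G D s} (f : substitution G D) : @up_sub _ _ s f _ vz = #0.
Proof. reflexivity. Qed.
Lemma up_sub_vs {G D s r} (f : substitution G D) (x : var G r) :
  @up_sub _ _ s f _ (vs x) = wk (f _ x).
Proof. reflexivity. Qed.
Lemma scons_vz {G D s} (u : tm D s) (f : substitution G D) : scons u f _ vz = u.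
Proof. reflexivity. Qed.
Lemma scons_vs {G D s r} (u : tm D s) (f : substitution G D) (x : var G r) :
  scons u f _ (vs x) = f _ x.
Proof. reflexivity. Qed.
Lemma up_ren_vz {G D s} (f : renaming G D) : @up_ren _ _ s f _ vz = vz.
Proof. reflexivity. Qed.
Lemma up_ren_vs {G D s r} (f : renaming G D) (x : var G r) :
  @up_ren _ _ s f _ (vs x) = vs (f _ x).
Proof. reflexivity. Qed.
Lemma shift_eq {G s r} (x : var G r) : @shift G s _ x = vs x.
Proof. reflexivity. Qed.

Lemma ren_Lt {G D} (f : renaming G D) (t u : tm G N) :
  ren_fm (t ≺ u) f = (ren_tm f t ≺ ren_tm f u).
Proof. unfold Lt. cbn [ren_fm ren_tm]. rewrite !ren_up_wk. reflexivity. Qed.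
Lemma sub_Lt {G D} (f : substitution G D) (t u : tm G N) :
  sub_fm (t ≺ u) f = (sub_tm f t ≺ sub_tm f u).
Proof. unfold Lt. cbn [sub_fm sub_tm]. rewrite !sub_up_wk. reflexivity. Qed.

Ltac sim := unfold inst, inst_suc, wk_fm;
  repeat (cbn [ren_tm sub_tm ren_fm sub_fm];
  match goal with
  | |- context [sub_tm (scons ?u ?f) (ren_tm shift ?t)] => rewrite (sub_scons_wk u f t)
  | |- context [sub_tm (up_sub ?f) (ren_tm shift ?t)] => rewrite (sub_up_wk f t)
  | |- context [ren_tm (up_ren ?f) (ren_tm shift ?t)] => rewrite (ren_up_wk f t)
  | |- context [sub_tm (fun _ x => Var x) ?t] => rewrite (sub_tm_Var t)
  | |- context [sub_tm (fun _ x => Var (vs x)) ?t] => rewrite (sub_tm_Var_vs t)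
  | |- context [scons ?u ?f _ vz] => rewrite (scons_vz u f)
  | |- context [scons ?u ?f _ (vs ?x)] => rewrite (scons_vs u f x)
  | |- context [up_sub ?f _ vz] => rewrite (up_sub_vz f)
  | |- context [up_sub ?f _ (vs ?x)] => rewrite (up_sub_vs f x)
  | |- context [up_ren ?f _ vz] => rewrite (up_ren_vz f)
  | |- context [up_ren ?f _ (vs ?x)] => rewrite (up_ren_vs f x)
  | |- context [@shift ?G ?s _ ?x] => rewrite (@shift_eq G s _ x)
  | |- context [@ren_tm ?G ?D ?f ?r (?k ?G)] => rewrite (@closed_ren r k _ G D f)
  | |- context [@sub_tm ?G ?D ?f ?r (?k ?G)] => rewrite (@closed_sub r k _ G D f)
  | |- context [ren_tm ?f cLen] => rewrite (ren_cLen f)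
  | |- context [sub_tm ?f cLen] => rewrite (sub_cLen f)
  | |- context [ren_tm ?f cNth] => rewrite (ren_cNth f)
  | |- context [sub_tm ?f cNth] => rewrite (sub_cNth f)
  | |- context [ren_tm ?f (lam ?t)] => rewrite (ren_lam f t)
  | |- context [sub_tm ?f (lam ?t)] => rewrite (sub_lam f t)
  | |- context [ren_fm (Eq ?t ?u) ?f] => rewrite (ren_Eq f t u)
  | |- context [sub_fm (Eq ?t ?u) ?f] => rewrite (sub_Eq f t u)
  | |- context [ren_fm (Lt ?t ?u) ?f] => rewrite (ren_Lt f t u)
  | |- context [sub_fm (Lt ?t ?u) ?f] => rewrite (sub_Lt f t u)
  end); cbn [ren_tm sub_tm ren_fm sub_fm].
Tactic Notation "sim" "in" hyp(h) := revert h; sim; intros h.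

(** * Provable equality as a congruence *)

Lemma E_fun {G} {H : list (fm G)} {s r} {f g : tm G (s ⇒ r)} x :
  E H f g -> E H (f · x) (g · x).
Proof.
  intros h. apply (prv_inst x) in h.
  rewrite inst_Eq in h. sim in h. exact h.
Qed.

Lemma Eq0_eucl {G} {H : list (fm G)} (t u v : tm G N) :
  prv H (t ≐ u) -> prv H (t ≐ v) -> prv H (u ≐ v).
Proof.
  intros a b. eapply nd_impE; [eapply nd_impE; [apply prv_epa, ax_trans|]|exact b].
  eapply nd_impE; [apply prv_epa, ax_sym | exact a].
Qed.

Lemma Lt_congr {G} {H : list (fm G)} (t u v : tm G N) :
  prv H (u ≐ v) -> prv H (t ≺ u) -> prv H (t ≺ v).
Proof.
  intros a b. apply (prv_ex (u ≐ v) b a). intros H' c d. sim in c. sim in d.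
  apply nd_exI with (t := #0). sim.
  eapply Eq0_eucl; [|exact c]. eapply Eq0_eucl; [exact d|]. apply prv_epa, ax_refl.
Qed.

Lemma E_nth {G} {H : list (fm G)} {s} {t u : tm G (s^*)} n :
  E H t u -> prv H (n ≺ cLen · t) -> E H (cNth · t · n) (cNth · u · n).
Proof.
  intros h l.
  assert (k : prv H (∀[N] (#0 ≺ cLen · wk t) ⊃ (cNth · wk t · #0 ≡ cNth · wk u · #0)))
    by exact (prv_and2 h).
  apply (prv_inst n) in k. sim in k. exact (prv_mp k l).
Qed.

(** With reflexivity, the Euclidean property yields both symmetry and transitivity, so one induction
    on types covers the two. *)
Lemma E_eucl {r G} (H : list (fm G)) (t u v : tm G r) : E H t u -> E H t v -> E H u v.
Proof.
  revert G H t u v; induction r as [|a IHa b IHb|a IHa]; intros G H t u v x y.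
  - exact (Eq0_eucl _ _ _ x y).
  - apply (prv_all ((t ≡ u) ∧ (t ≡ v))); [now apply nd_andI|]. intros H' h. sim in h.
    apply IHb with (t := wk t · #0); apply E_fun; [exact (prv_and1 h)|
    exact (prv_and2 h)].
  - pose proof (prv_and1 x) as x1. pose proof (prv_and1 y) as y1.
    apply nd_andI; [exact (Eq0_eucl _ _ _ x1 y1)|].
    apply (prv_all ((t ≡ u) ∧ (t ≡ v))); [now apply nd_andI|]. clear - IHa. intros H h. sim in h.
    pose proof (prv_and1 h) as x. pose proof (prv_and2 h) as y.
    clear h. apply prv_imp. world H'. intros l.
    (* The index is bounded by the length of [u], whereas [E_nth] asks for the length of [t]. *)
    assert (l' : prv H' (#0 ≺ cLen · wk t)).
    { eapply Lt_congr; [|exact l].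
      eapply Eq0_eucl; [exact (prv_and1 x)|apply prv_epa, ax_refl]. }
    apply IHa with (t := cNth · wk t · #0); now apply E_nth.
Qed.

#[local] Instance E_equiv {G} (H : list (fm G)) r : Equivalence (@E G H r).
Proof.
  split; repeat intro.
  - apply Eq_refl.
  - eapply E_eucl; [eassumption|]. apply Eq_refl.
  - eapply E_eucl; [|eassumption]. eapply E_eucl; [eassumption|]. apply Eq_refl.
Qed.

(** In function position this is the definition of equality at arrow types; in argument position it
    is the axiom of extensionality. *)
#[local] Instance App_E {G} (H : list (fm G)) s r :
  Proper (E H ==> E H ==> E H) (@App G s r).
Proof.
  intros f g h t u k. transitivity (f · u); [|now apply E_fun].
  eapply nd_impE; [apply prv_epa, ax_ext | exact k].
Qed.

(** * Conversion rules for combinators, abstraction and recursion *)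

Lemma E_Pi {G} (H : list (fm G)) r s (t : tm G r) (u : tm G s) :
  E H (Cst (cPi r s) · t · u) t.
Proof. apply prv_epa, ax_Pi. Qed.

Lemma E_Sigma {G} (H : list (fm G)) r s v (f : tm G (r ⇒ s ⇒ v)) g (t : tm G r) :
  E H (Cst (cSigma r s v) · f · g · t) (f · t · (g · t)).
Proof. apply prv_epa, ax_Sigma. Qed.

(** Each clause of [lam] is matched by one combinator equation; in the one-step clause both parts
    are weakenings, on which the substitution of [u] has no effect. *)
Lemma E_beta {G} (H : list (fm G)) s r (t : tm (s :: G) r) (u : tm G s) :
  E H (lam t · u) (sub_tm (scons u (fun _ x => Var x)) t).
Proof.
  induction t as [r x|r c|q r t IHt t' IHt'].
  - revert r x. apply var_cons_case; [|intros]; cbn.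
    + rewrite E_Sigma, E_Pi. reflexivity.
    + apply E_Pi.
  - apply E_Pi.
  - cbn. destruct (strengthen t) eqn:e, (strengthen t') eqn:e';
    try (rewrite E_Sigma, IHt, IHt'; reflexivity).
    apply strengthen_some in e, e'. subst. rewrite E_Pi.
    rewrite !sub_scons_wk, !sub_tm_Var. reflexivity.
Qed.

Lemma E_R0 {G} (H : list (fm G)) r (a : tm G r) f : E H (Rec zero a f) a.
Proof. apply prv_epa, ax_R0. Qed.
Lemma E_RS {G} (H : list (fm G)) r n (a : tm G r) f :
  E H (Rec (Suc n) a f) (f · Rec n a f · n).
Proof. apply prv_epa, ax_RS. Qed.

#[local] Instance cPred_closed : closed_tm (@cPred).
Proof. split; reflexivity. Qed.
#[local] Instance cMonus_closed : closed_tm (@cMonus).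
Proof. split; reflexivity. Qed.
#[local] Instance cIfz_closed : closed_tm (@cIfz).
Proof. split; reflexivity. Qed.
#[local] Instance cTri_closed : closed_tm (@cTri).
Proof. split; reflexivity. Qed.
#[local] Instance cPair_closed : closed_tm (@cPair).
Proof. split; reflexivity. Qed.
#[local] Instance cDiag_closed : closed_tm (@cDiag).
Proof. split; reflexivity. Qed.
#[local] Instance cFst_closed : closed_tm (@cFst).
Proof. split; reflexivity. Qed.
#[local] Instance cInit_closed : closed_tm (@cInit).
Proof. split; reflexivity. Qed.
#[local] Instance cInits_closed : closed_tm (@cInits).
Proof. split; reflexivity. Qed.
#[local] Instance cLh_closed : closed_tm (@cLh).
Proof. split; reflexivity. Qed.
#[local] Instance cSeg_closed : closed_tm (@cSeg).
Proof. split; reflexivity. Qed.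
#[local] Instance cTake_closed : closed_tm (@cTake).
Proof. split; reflexivity. Qed.

(** The partial counts of [cLh]: the number of [n < k] with [cInits · n · s <> <>]. *)
Definition cCount {G} : tm G (N ⇒ N ⇒ N) :=
  λ λ Rec #0 zero (λ λ cIfz · (cInits · #0 · #3) · #1 · Suc #1).
#[local] Instance cCount_closed : closed_tm (@cCount).
Proof. split; reflexivity. Qed.

(** The function to which transfer is applied. As a closed combinator it is standard, and so are its
    values at standard arguments. *)
Definition cAlong {G} : tm G ((N ⇒ N) ⇒ (N ⇒ N) ⇒ N ⇒ N) := λ λ λ #2 · seg #1 #0.
#[local] Instance cAlong_closed : closed_tm (@cAlong).
Proof. split; reflexivity. Qed.

(** [cStop · f · n] is the least [i < n] with [f i <> 0], or [n] if there is none. *)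
Definition cStop {G} : tm G ((N ⇒ N) ⇒ N ⇒ N) :=
  λ λ Rec #0 zero (λ λ cIfz · (#3 · #1) · Suc #1 · #1).
#[local] Instance cStop_closed : closed_tm (@cStop).
Proof. split; reflexivity. Qed.

(** If [cStop] finds nothing below the length of the argument, it returns that length, so the test
    of [f] also covers the length itself: an answer appears as soon as the length reaches the least
    place where [f] is nonzero. The successor is the usual shift by one in the values of an
    associate. *)
Definition cAssoc {G} : tm G ((N ⇒ N) ⇒ N ⇒ N) :=
  λ λ cIfz · (#1 · (cStop · #1 · (cLh · #0))) · zero ·
      Suc (take #0 (cStop · #1 · (cLh · #0))).
#[local] Instance cAssoc_closed : closed_tm (@cAssoc).
Proof. split; reflexivity. Qed.

(** The shift moves the least place [μ] with [f μ <> 0] to index [μ - 1], the last entry of the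
    initial segment of length [μ]. *)
Definition cTail {G} : tm G ((N ⇒ N) ⇒ N ⇒ N) := λ λ #1 · Suc #0.
#[local] Instance cTail_closed : closed_tm (@cTail).
Proof. split; reflexivity. Qed.

Definition cConst0 {G} : tm G (N ⇒ N) := λ zero.
#[local] Instance cConst0_closed : closed_tm (@cConst0).
Proof. split; reflexivity. Qed.

(** From here on unification must not see the combinators behind [lam]. *)
#[local] Opaque lam.

(** Consumes the next argument of a curried term while the substitution of the earlier ones is still
    pending. *)
Lemma E_sub_lam {G D} (H : list (fm D)) s r (f : substitution G D) (t : tm (s :: G) r) x :
  E H (sub_tm f (lam t) · x) (sub_tm (scons x f) t).
Proof. rewrite sub_lam, E_beta, sub_scons_up. reflexivity. Qed.

Ltac beta := try rewrite E_beta; rewrite ?E_sub_lam; cbn [sub_tm];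
  rewrite ?scons_vz, ?scons_vs, ?scons_vz, ?scons_vs.
Ltac sub_const := repeat match goal with
  | |- context [@sub_tm ?G ?D ?f ?r (?k ?G)] => rewrite (@closed_sub r k _ G D f)
  end.

(** The step is required under an arbitrary list of hypotheses, so it cannot draw on [H]; inductions
    that need side conditions use [prv_ind_with] instead. *)
Lemma ind_eq {G} {H : list (fm G)} (a b : tm (N :: G) N) t :
  E H (sub_tm (scons zero (fun _ x => Var x)) a) (sub_tm (scons zero (fun _ x => Var x)) b) ->
  (forall H', E H' a b ->
     E H' (sub_tm (scons (Suc #0) (fun _ x => Var (vs x))) a)
          (sub_tm (scons (Suc #0) (fun _ x => Var (vs x))) b)) ->
  E H (sub_tm (scons t (fun _ x => Var x)) a) (sub_tm (scons t (fun _ x => Var x)) b).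
Proof.
  intros z s. apply (prv_ind_with (Bot ⊃ Bot) (a ≐ b)).
  - exact I.
  - apply nd_impI, nd_hyp, in_eq.
  - exact z.
  - intros H' _. apply s.
Qed.

Tactic Notation "induct" uconstr(a) uconstr(b) uconstr(t) :=
  let k := fresh in
  match goal with |- @E ?G ?H _ _ _ =>
    pose proof (@ind_eq G H a b t) as k; sim in k; apply k; clear k end.

(** * Defining equations of the arithmetical and coding functions *)

Section Computation.
Context {G : ctx} {H : list (fm G)}.
Implicit Types x y z : tm G N.

Lemma plus_zero x : E H (x + zero) x.
Proof. unfold cPlus. beta. apply E_R0. Qed.
Lemma plus_Suc x y : E H (x + Suc y) (Suc (x + y)).
Proof. unfold cPlus. beta. rewrite E_RS. beta. sub_const. reflexivity. Qed.
Lemma pred_zero : E H (cPred · zero) zero.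
Proof. unfold cPred. beta. apply E_R0. Qed.
Lemma pred_Suc x : E H (cPred · Suc x) x.
Proof. unfold cPred. beta. rewrite E_RS. beta. sub_const. reflexivity. Qed.
#[local] Opaque cPlus cPred.
Lemma monus_zero x : E H (x - zero) x.
Proof. unfold cMonus. beta. apply E_R0. Qed.
Lemma monus_Suc x y : E H (x - Suc y) (cPred · (x - y)).
Proof. unfold cMonus. beta. rewrite E_RS. beta. sub_const. reflexivity. Qed.
Lemma ifz_zero x y : E H (cIfz · zero · x · y) x.
Proof. unfold cIfz. beta. apply E_R0. Qed.
Lemma ifz_Suc x y z : E H (cIfz · Suc z · x · y) y.
Proof. unfold cIfz. beta. rewrite E_RS. beta. sub_const. reflexivity. Qed.
#[local] Opaque cMonus cIfz.
Lemma tri_zero : E H (cTri · zero) zero.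
Proof. unfold cTri. beta. apply E_R0. Qed.
Lemma tri_Suc x : E H (cTri · Suc x) (cTri · x + Suc x).
Proof. unfold cTri. beta. rewrite E_RS. beta. sub_const. reflexivity. Qed.
#[local] Opaque cTri.
Lemma pair_eq x y : E H (cPair · x · y) (cTri · (x + y) + y).
Proof. unfold cPair. beta. sub_const. reflexivity. Qed.
#[local] Opaque cPair.
Lemma diag_zero : E H (cDiag · zero) zero.
Proof. unfold cDiag. beta. apply E_R0. Qed.
Lemma diag_Suc x : E H (cDiag · Suc x)
  (cIfz · (cTri · Suc (cDiag · x) - Suc x) · Suc (cDiag · x) · (cDiag · x)).
Proof. unfold cDiag. beta. rewrite E_RS. beta. sub_const. reflexivity. Qed.
#[local] Opaque cDiag.
Lemma fst_eq x : E H (cFst · x) (cDiag · x - (x - cTri · (cDiag · x))).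
Proof. unfold cFst. beta. sub_const. reflexivity. Qed.
#[local] Opaque cFst.
Lemma init_eq x : E H (cInit · x) (cIfz · x · zero · (cFst · (cPred · x))).
Proof. unfold cInit. beta. sub_const. reflexivity. Qed.
#[local] Opaque cInit.
Lemma inits_zero x : E H (cInits · zero · x) x.
Proof. unfold cInits. beta. apply E_R0. Qed.
Lemma inits_Suc x y : E H (cInits · Suc x · y) (cInit · (cInits · x · y)).
Proof. unfold cInits. beta. rewrite E_RS. beta. sub_const. reflexivity. Qed.
#[local] Opaque cInits.
Lemma seg_zero (a : tm G (N ⇒ N)) : E H (seg a zero) zero.
Proof. unfold cSeg. beta. apply E_R0. Qed.
Lemma seg_Suc (a : tm G (N ⇒ N)) x : E H (seg a (Suc x)) (Suc (cPair · seg a x · (a · x))).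
Proof. unfold cSeg. beta. rewrite E_RS. beta. sub_const. reflexivity. Qed.
#[local] Opaque cSeg.
Lemma take_eq x y : E H (take x y) (cInits · (cLh · x - y) · x).
Proof. unfold cTake. beta. sub_const. reflexivity. Qed.
End Computation.

(** Separates the two roles of [s], as sequence and as bound of the count, so that induction can run
    on the bound alone. *)
Lemma lh_eq {G} {H : list (fm G)} (s : tm G N) : E H (cLh · s) (cCount · s · s).
Proof. unfold cLh. beta. symmetry. unfold cCount. beta. sim. reflexivity. Qed.
Lemma count_zero {G} {H : list (fm G)} (s : tm G N) : E H (cCount · s · zero) zero.
Proof. unfold cCount. beta. apply E_R0. Qed.
Lemma count_Suc {G} {H : list (fm G)} (s n : tm G N) : E H (cCount · s · Suc n)
  (cIfz · (cInits · n · s) · (cCount · s · n) · Suc (cCount · s · n)).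
Proof. unfold cCount. beta. rewrite E_RS. beta. sub_const. reflexivity. Qed.

#[local] Opaque cPlus cPred cMonus cIfz cTri cPair cDiag cFst cInit cInits cLh cSeg cTake cCount.

(** * Arithmetic *)

Lemma prv_true {G} {H : list (fm G)} : prv H (Bot ⊃ Bot).
Proof. apply nd_impI, nd_hyp, in_eq. Qed.

Lemma Suc_neq {G} {H : list (fm G)} {x} {c : fm G} : E H (Suc x) zero -> prv H c.
Proof. intros h. apply prv_bot. eapply nd_impE; [apply prv_epa, ax_Suc_neq|exact h]. Qed.

Lemma Suc_inj {G} {H : list (fm G)} x y : E H (Suc x) (Suc y) -> E H x y.
Proof. intros h. rewrite <- (pred_Suc x), h. apply pred_Suc. Qed.

(** In the successor case the predecessor term [cPred · x] is supplied for [y], so no existential is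
    opened and the context does not change. *)
Lemma nat_case {G} {H : list (fm G)} x {c : fm G} :
  (forall H', incl H H' -> E H' x zero -> prv H' c) ->
  (forall H' y, incl H H' -> E H' x (Suc y) -> prv H' c) -> prv H c.
Proof.
  intros k l. apply (@prv_or _ _ (x ≐ zero) (x ≐ Suc (cPred · x))); [|exact k|].
  - pose proof (prv_ind_with (H := H) (Bot ⊃ Bot) (#0 ≐ zero ∨ #0 ≐ Suc (cPred · #0)) x) as i.
    sim. apply i; [cbn; auto|apply prv_true|apply nd_orI1, prv_epa, ax_refl|].
    intros. apply nd_orI2. change (E H' (Suc #0) (Suc (cPred · Suc #0))).
    now rewrite pred_Suc.
  - intros H' i. apply l, i.
Qed.

Tactic Notation "ncase" uconstr(x) "as" ident(y) ident(h) :=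
  match goal with
  | |- @E ?G ?H ?r ?a ?b => refine (@nat_case G H x (@Eq G r a b) _ _)
  | |- _ => apply (nat_case x)
  end;
  [intros ?H ?i h; lift i | intros ?H y ?i h; lift i];
  match goal with
  | |- nd P_ax ?G ?H (@Eq _ ?r ?a ?b) => change (@E G H r a b)
  | |- _ => idtac
  end.

Lemma zero_plus {G} {H : list (fm G)} x : E H (zero + x) x.
Proof.
  induct (zero + #0) #0 x; [apply plus_zero|]. intros H' IH.
  rewrite plus_Suc, IH. reflexivity.
Qed.

Lemma Suc_plus {G} {H : list (fm G)} x y : E H (Suc x + y) (Suc (x + y)).
Proof.
  induct (Suc (wk x) + #0) (Suc (wk x + #0)) y; [now rewrite !plus_zero|]. intros H' IH.
  now rewrite !plus_Suc, IH.
Qed.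
Lemma plus_comm {G} {H : list (fm G)} x y : E H (x + y) (y + x).
Proof.
  induct (wk x + #0) (#0 + wk x) y; [now rewrite plus_zero, zero_plus|]. intros H' IH.
  now rewrite plus_Suc, Suc_plus, IH.
Qed.

Lemma plus_assoc {G} {H : list (fm G)} x y z : E H (x + (y + z)) (x + y + z).
Proof.
  induct (wk x + (wk y + #0)) (wk x + wk y + #0) z; [now rewrite !plus_zero|]. intros H' IH.
  now rewrite !plus_Suc, IH.
Qed.

Lemma monus_Suc_Suc {G} {H : list (fm G)} x y : E H (Suc x - Suc y) (x - y).
Proof.
  induct (Suc (wk x) - Suc #0) (wk x - #0) y.
  - now rewrite monus_Suc, !monus_zero, pred_Suc.
  - intros H' IH. now rewrite monus_Suc, IH, monus_Suc.
Qed.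

Lemma zero_monus {G} {H : list (fm G)} x : E H (zero - x) zero.
Proof.
  induct (zero - #0) zero x; [now rewrite monus_zero|]. intros H' IH.
  now rewrite monus_Suc, IH, pred_zero.
Qed.

Lemma monus_cancel {G} {H : list (fm G)} x y z : E H ((z + x) - (z + y)) (x - y).
Proof.
  induct ((#0 + wk x) - (#0 + wk y)) (wk x - wk y) z; [now rewrite !zero_plus|].
  intros H' IH. now rewrite !Suc_plus, monus_Suc_Suc, IH.
Qed.

Lemma plus_monus_l {G} {H : list (fm G)} x y : E H (x + y - x) y.
Proof. rewrite <- (plus_zero x) at 2. now rewrite monus_cancel, monus_zero. Qed.

Lemma plus_monus_r {G} {H : list (fm G)} x y : E H (x + y - y) x.
Proof. rewrite plus_comm. apply plus_monus_l. Qed.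

Lemma monus_plus {G} {H : list (fm G)} x y : E H (x - (x + y)) zero.
Proof. rewrite <- (plus_zero x) at 1. now rewrite monus_cancel, zero_monus. Qed.

Lemma monus_diag {G} {H : list (fm G)} x : E H (x - x) zero.
Proof. rewrite <- (plus_zero x) at 2. apply monus_plus. Qed.

Lemma monus_monus {G} {H : list (fm G)} x y z : E H (x - y - z) (x - (y + z)).
Proof.
  induct (wk x - wk y - #0) (wk x - (wk y + #0)) z; [now rewrite monus_zero, plus_zero|].
  intros H' IH. now rewrite plus_Suc, !monus_Suc, IH.
Qed.

(** The second equation says that [x - y] or [y - x] vanishes. *)
Lemma max_comm_total {G} {H : list (fm G)} x y :
  prv H ((x + (y - x) ≐ y + (x - y)) ∧ (cIfz · (x - y) · zero · (y - x) ≐ zero)).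
Proof.
  pose proof (prv_ind_with (H := H) (Bot ⊃ Bot)
    (∀[N] (#1 + (#0 - #1) ≐ #0 + (#1 - #0)) ∧ (cIfz · (#1 - #0) · zero · (#0 - #1) ≐ zero)) x) as k.
  apply (prv_inst y) in k;
    [sim in k; exact k|cbn; auto|apply prv_true| |]; clear.
  - apply nd_allI. sim. apply nd_andI; as_E.
    + now rewrite zero_monus, zero_plus, monus_zero, plus_zero.
    + now rewrite zero_monus, ifz_zero.
  - intros H' _ IH. apply (prv_all _ IH). clear. intros H h. sim. sim in h.
    apply (nat_case #0).
    + world H'. intros e. apply nd_andI; as_E; rewrite e.
      * now rewrite zero_monus, zero_plus, monus_zero, plus_zero.
      * now rewrite monus_zero, ifz_Suc, zero_monus.
    + intros H' y i e; lift i. apply (prv_inst y) in h. sim in h.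
      pose proof (E_intro (prv_and1 h)) as h1.
      pose proof (E_intro (prv_and2 h)) as h2.
      apply nd_andI; as_E;
        rewrite e, !monus_Suc_Suc.
      * now rewrite !Suc_plus, h1.
      * exact h2.
Qed.

Lemma max_comm {G} {H : list (fm G)} x y : E H (x + (y - x)) (y + (x - y)).
Proof. exact (prv_and1 (max_comm_total x y)). Qed.

(** The order is expressed by [x - y = 0]; the difference [y - x] is then an explicit witness. *)
Lemma le_wit {G} {H : list (fm G)} x y : E H (x - y) zero -> E H y (x + (y - x)).
Proof. intros h. now rewrite max_comm, h, plus_zero. Qed.

Lemma le_trans {G} {H : list (fm G)} x y z :
  E H (x - y) zero -> E H (y - z) zero -> E H (x - z) zero.
Proof.
  intros a b. rewrite (le_wit _ _ b), (le_wit _ _ a), <- plus_assoc. apply monus_plus.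
Qed.

Lemma le_antisym {G} {H : list (fm G)} x y :
  E H (x - y) zero -> E H (y - x) zero -> E H x y.
Proof. intros a b. now rewrite (le_wit _ _ a), b, plus_zero. Qed.

Lemma le_Suc {G} {H : list (fm G)} x : E H (x - Suc x) zero.
Proof. now rewrite monus_Suc, monus_diag, pred_zero. Qed.

Lemma monus_le {G} {H : list (fm G)} x y : E H (x - y - x) zero.
Proof. rewrite monus_monus, plus_comm. apply monus_plus. Qed.

Lemma le_pred {G} {H : list (fm G)} x y :
  E H (x - y) zero -> E H (cPred · x - cPred · y) zero.
Proof.
  intros h. ncase x as x' e.
  - now rewrite e, pred_zero, zero_monus.
  - ncase y as y' e'.
    + rewrite e, e', monus_zero in h. exact (Suc_neq h).
    + rewrite e, e', !pred_Suc, <- monus_Suc_Suc, <- e, <- e'. exact h.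
Qed.

Lemma le_case {G} {H : list (fm G)} x y {c : fm G} :
  (forall H' z, incl H H' -> E H' y (x + z) -> prv H' c) ->
  (forall H' z, incl H H' -> E H' x (y + Suc z) -> prv H' c) -> prv H c.
Proof.
  intros k l. apply (nat_case (x - y)).
  - intros H' i e. apply (k H' (y - x) i), le_wit, e.
  - intros H' z i e. apply (l H' z i). rewrite <- e, <- max_comm.
    assert (t : E H' (cIfz · (x - y) · zero · (y - x)) zero)
      by exact (prv_and2 (max_comm_total x y)).
    rewrite e, ifz_Suc in t. now rewrite t, plus_zero.
Qed.

Tactic Notation "lecase" uconstr(x) uconstr(y) "as" ident(z) ident(h) :=
  match goal with
  | |- @E ?G ?H ?r ?a ?b => refine (@le_case G H x y (@Eq G r a b) _ _)
  | |- _ => apply (le_case x y)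
  end;
  [intros ?H z ?i h; lift i | intros ?H z ?i h; lift i];
  match goal with
  | |- nd P_ax ?G ?H (@Eq _ ?r ?a ?b) => change (@E G H r a b)
  | |- _ => idtac
  end.

(** * Coded sequences *)

(** From the start of the diagonal with sum [r + q], the next [r] steps stay below the start of the
    following one, so [cDiag] does not change. Writing the sum as [r + q] encodes that [r] is at
    most the sum; the induction on [r] keeps the sum fixed, hence the quantifier over [q]. *)
Lemma diag_row {G} {H : list (fm G)} r q :
  E H (cDiag · (cTri · (r + q))) (r + q) -> E H (cDiag · (cTri · (r + q) + r)) (r + q).
Proof.
  pose proof (prv_ind_with (H := H) (Bot ⊃ Bot)
    (∀[N] (cDiag · (cTri · (#1 + #0)) ≐ #1 + #0) ⊃
          (cDiag · (cTri · (#1 + #0) + #1) ≐ #1 + #0)) r) as k.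
  apply (prv_inst q) in k;
    [sim in k; apply (prv_mp k)|cbn; auto|apply prv_true| |]; clear.
  - apply nd_allI. sim. apply prv_imp. world H'. intros h.
    change (E H' (cDiag · (cTri · (zero + #0) + zero)) (zero + #0)). now rewrite plus_zero.
  - intros H' _ IH. apply (prv_all _ IH). clear. intros H h. sim. sim in h.
    apply prv_imp. world H'. intros e.
    (* Raising [q] by one compensates for the smaller [r] in the induction hypothesis. *)
    apply (prv_inst (Suc #0)) in h. sim in h.
    change (E H' (cDiag · (cTri · (Suc #1 + #0) + Suc #1)) (Suc #1 + #0)).
    apply E_intro in e.
    assert (s : E H' (#1 + Suc #0) (Suc #1 + #0)) by now rewrite plus_Suc, Suc_plus.
    assert (h' : E H' (cDiag · (cTri · (#1 + Suc #0) + #1)) (#1 + Suc #0)).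
    { apply (prv_mp h). change (E H' (cDiag · (cTri · (#1 + Suc #0))) (#1 + Suc #0)).
      now rewrite s. }
    rewrite s in h'.
    rewrite plus_Suc, diag_Suc, h', tri_Suc, <- (plus_Suc (cTri · _)), monus_cancel, monus_Suc_Suc, <- s.
    now rewrite plus_monus_l, ifz_Suc.
Qed.

(** By [diag_row] with [q = 0], the diagonal [x] extends to [tri x + x]. The successor of that
    number is [tri (S x)], where the test in [cDiag] vanishes and the diagonal advances. *)
Lemma diag_tri {G} {H : list (fm G)} x : E H (cDiag · (cTri · x)) x.
Proof.
  induct (cDiag · (cTri · #0)) #0 x; [now rewrite tri_zero, diag_zero|]. intros H' IH.
  assert (h : E H' (cDiag · (cTri · #0 + #0)) #0).
  { rewrite <- (plus_zero #0) at 1 3. apply diag_row. now rewrite plus_zero. }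
  rewrite tri_Suc, plus_Suc, diag_Suc, h, tri_Suc, <- (plus_Suc (cTri · _)), monus_diag.
  apply ifz_zero.
Qed.

Lemma diag_pair {G} {H : list (fm G)} x y : E H (cDiag · (cPair · x · y)) (x + y).
Proof. rewrite pair_eq, (plus_comm x y). apply diag_row, diag_tri. Qed.

Lemma snd_pair {G} {H : list (fm G)} x y :
  E H (cPair · x · y - cTri · (cDiag · (cPair · x · y))) y.
Proof. rewrite diag_pair, pair_eq. apply plus_monus_l. Qed.

Lemma fst_pair {G} {H : list (fm G)} x y : E H (cFst · (cPair · x · y)) x.
Proof. rewrite fst_eq, snd_pair, diag_pair. apply plus_monus_r. Qed.

Lemma diag_le {G} {H : list (fm G)} x : E H (cDiag · x - x) zero.
Proof.
  induct (cDiag · #0 - #0) zero x; [now rewrite diag_zero, monus_zero|]. intros H' IH.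
  rewrite diag_Suc.
  set (d := cTri · Suc (cDiag · #0) - Suc #0). ncase d as z e; rewrite e.
  - now rewrite ifz_zero, monus_Suc_Suc.
  - rewrite ifz_Suc. apply (le_trans _ _ _ IH), le_Suc.
Qed.

Lemma init_zero {G} {H : list (fm G)} : E H (cInit · zero) zero.
Proof. now rewrite init_eq, ifz_zero. Qed.

Lemma init_Suc {G} {H : list (fm G)} x : E H (cInit · Suc x) (cFst · x).
Proof. now rewrite init_eq, ifz_Suc, pred_Suc. Qed.

(** A first projection is bounded by the diagonal and thus by the pair, so removing an entry
    strictly lowers a nonzero code. This is why [s] removals empty the sequence [s]. *)
Lemma init_le_pred {G} {H : list (fm G)} x : E H (cInit · x - cPred · x) zero.
Proof.
  ncase x as y e; rewrite e.
  - now rewrite init_zero, zero_monus.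
  - rewrite init_Suc, pred_Suc, fst_eq. apply (le_trans _ (cDiag · y)); [apply monus_le|].
    apply diag_le.
Qed.

Lemma inits_plus {G} {H : list (fm G)} x y s :
  E H (cInits · x · (cInits · y · s)) (cInits · (y + x) · s).
Proof.
  induct (cInits · #0 · (cInits · wk y · wk s)) (cInits · (wk y + #0) · wk s) x.
  - now rewrite inits_zero, plus_zero.
  - intros H' IH. now rewrite plus_Suc, !inits_Suc, IH.
Qed.

Lemma inits_nil {G} {H : list (fm G)} x : E H (cInits · x · zero) zero.
Proof.
  induct (cInits · #0 · zero) zero x; [apply inits_zero|]. intros H' IH.
  now rewrite inits_Suc, IH, init_zero.
Qed.

Lemma inits_zero_plus {G} {H : list (fm G)} x y s :
  E H (cInits · x · s) zero -> E H (cInits · (x + y) · s) zero.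
Proof. intros h. now rewrite <- inits_plus, h, inits_nil. Qed.

Lemma inits_self {G} {H : list (fm G)} s : E H (cInits · s · s) zero.
Proof.
  assert (h : E H (cInits · s · s - (s - s)) zero).
  { induct (cInits · #0 · wk s - (wk s - #0)) zero s.
    - now rewrite inits_zero, monus_zero, monus_diag.
    - intros H' IH. rewrite inits_Suc, monus_Suc.
      apply (le_trans _ _ _ (init_le_pred _)). now apply le_pred. }
  now rewrite monus_diag, monus_zero in h.
Qed.

(** Invariant of the count: either that many removals already empty [s], or every index so far has
    been counted. At the bound [s] the second alternative is settled by [inits_self]. *)
Lemma inits_lh {G} {H : list (fm G)} s : E H (cInits · (cLh · s) · s) zero.
Proof.
  rewrite lh_eq.
  pose proof (prv_ind_with (H := H) (Bot ⊃ Bot)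
    (cInits · (cCount · wk s · #0) · wk s ≐ zero ∨ cCount · wk s · #0 ≐ #0) s) as k.
  sim in k.
  assert (d : prv H (cInits · (cCount · s · s) · s ≐ zero ∨ cCount · s · s ≐ s)).
  { apply k; [cbn; auto|apply prv_true|apply nd_orI2, count_zero|]. clear.
    intros H _ IH. apply (nat_case (cInits · #0 · wk s)).
    - world H'. intros e. apply nd_orI1.
      change (E H' (cInits · (cCount · wk s · Suc #0) · wk s) zero).
      rewrite count_Suc, e, ifz_zero.
      apply (prv_or IH); [auto|]. world H0. intros f.
      apply E_intro in f. change (E H0 (cInits · (cCount · wk s · #0) · wk s) zero).
      now rewrite f.
    - intros H' y i e; lift i. apply (prv_or IH); world H0; intros f.
      + apply nd_orI1. change (E H0 (cInits · (cCount · wk s · Suc #0) · wk s) zero).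
        apply E_intro in f.
        now rewrite count_Suc, e, ifz_Suc, inits_Suc, f, init_zero.
      + apply nd_orI2. change (E H0 (cCount · wk s · Suc #0) (Suc #0)).
        apply E_intro in f.
        now rewrite count_Suc, e, ifz_Suc, f. }
  clear k. apply (prv_or d); [auto|]. world H'. intros f.
  apply E_intro in f. change (E H' (cInits · (cCount · s · s) · s) zero).
  rewrite f. apply inits_self.
Qed.

(** Minimality of the length. The bound by [j] is proved together with the bound by the index: the
    count grows only at indices below [j], and there the second bound gives the first. *)
Lemma lh_le {G} {H : list (fm G)} j s :
  E H (cInits · j · s) zero -> E H (cLh · s - j) zero.
Proof.
  intros h. rewrite lh_eq.
  pose proof (prv_ind_with (H := H) (cInits · j · s ≐ zero)
    ((cCount · wk s · #0 - #0 ≐ zero) ∧ (cCount · wk s · #0 - wk j ≐ zero)) s) as k.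
  sim in k. refine (prv_and2 (k _ h _ _)); clear.
  - cbn; auto.
  - apply nd_andI; [change (E H (cCount · s · zero - zero) zero)|
      change (E H (cCount · s · zero - j) zero)]; rewrite count_zero; apply zero_monus.
  - intros H h IH. apply E_intro in h.
    pose proof (E_intro (prv_and1 IH)) as h1.
    pose proof (E_intro (prv_and2 IH)) as h2.
    clear IH.
    enough (k : E H (cCount · wk s · Suc #0 - Suc #0) zero /\ E H (cCount · wk s · Suc #0 - wk j) zero)
      by (apply nd_andI; apply k).
    split; rewrite count_Suc; ncase (cInits · #0 · wk s) as y e; rewrite e.
    + rewrite ifz_zero. apply (le_trans _ _ _ h1), le_Suc.
    + now rewrite ifz_Suc, monus_Suc_Suc.
    + now rewrite ifz_zero.
    (* The index was counted, so the sequence is not yet empty there; this excludes that [j] is at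
       most the index. *)
    + rewrite ifz_Suc. lecase (wk j) (#0) as w f.
      * rewrite f, inits_zero_plus in e by exact h. symmetry in e. exact (Suc_neq e).
      * rewrite f, plus_Suc, monus_Suc_Suc.
        apply (le_trans _ _ _ h1), monus_plus.
Qed.

(** Both inequalities come from minimality in [lh_le], since successive removals add up. *)
Lemma lh_inits {G} {H : list (fm G)} j s : E H (cLh · (cInits · j · s)) (cLh · s - j).
Proof.
  apply le_antisym.
  - apply lh_le. rewrite inits_plus, max_comm. apply inits_zero_plus, inits_lh.
  - rewrite monus_monus. apply lh_le. rewrite <- inits_plus. apply inits_lh.
Qed.

Lemma init_seg {G} {H : list (fm G)} (a : tm G (N ⇒ N)) x : E H (cInit · seg a (Suc x)) (seg a x).
Proof. now rewrite seg_Suc, init_Suc, fst_pair. Qed.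

Lemma inits_seg {G} {H : list (fm G)} (a : tm G (N ⇒ N)) x y :
  E H (cInits · y · seg a (x + y)) (seg a x).
Proof.
  induct (cInits · #0 · seg (wk a) (wk x + #0)) (seg (wk a) (wk x)) y.
  - now rewrite inits_zero, plus_zero.
  - intros H' IH.
    (* [inits_Suc] would perform the extra removal last; the sum is reordered so that it comes first
       and meets the last entry of the segment. *)
    rewrite <- (plus_zero #0), <- plus_Suc, (plus_comm #0), <- inits_plus.
    now rewrite inits_Suc, inits_zero, Suc_plus, zero_plus, plus_Suc, init_seg, IH.
Qed.

(** The length is at most [k]. If [w] is the difference, removing as many entries as the length
    leaves [seg a w], which must be empty; hence [w] is zero. *)
Lemma lh_seg {G} {H : list (fm G)} (a : tm G (N ⇒ N)) k : E H (cLh · seg a k) k.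
Proof.
  assert (l : E H (cLh · seg a k - k) zero).
  { apply lh_le. rewrite <- (zero_plus k) at 2. now rewrite inits_seg, seg_zero. }
  apply le_wit in l. revert l. generalize (k - cLh · seg a k). intros w l.
  pose proof (inits_seg (H := H) a w (cLh · seg a k)) as e.
  rewrite (plus_comm w), <- l, inits_lh in e.
  ncase w as v f.
  - rewrite f, plus_zero in l. now symmetry.
  - rewrite f, seg_Suc in e. symmetry in e. exact (Suc_neq e).
Qed.

Lemma take_seg {G} {H : list (fm G)} (a : tm G (N ⇒ N)) x y :
  E H (take (seg a (x + y)) x) (seg a x).
Proof. rewrite take_eq, lh_seg, plus_monus_l. apply inits_seg. Qed.

(** * Transfer implies nonstandard continuity *)

(** Replaces the existential hidden in [≺] by the predecessor, so that positivity can be used in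
    rewriting. *)
Lemma pos_E {G} {H : list (fm G)} {t : tm G N} :
  prv H (zero ≺ t) -> E H t (Suc (cPred · t)).
Proof.
  intros h. apply (prv_ex (c := t ≐ Suc (cPred · t)) (Bot ⊃ Bot) h prv_true).
  intros H' _ e. sim in e. apply E_intro in e. sim. as_E.
  now rewrite <- e, zero_plus, pred_Suc.
Qed.

Lemma Suc_pos {G} {H : list (fm G)} {t z : tm G N} : E H t (Suc z) -> prv H (zero ≺ t).
Proof.
  intros h. apply nd_exI with (t := z). sim. as_E. now rewrite zero_plus.
Qed.

Lemma pos_congr {G} {H : list (fm G)} {t u : tm G N} :
  E H t u -> prv H (zero ≺ t) -> prv H (zero ≺ u).
Proof. apply Lt_congr. Qed.

Lemma ren_InC {G D} (f : renaming G D) g : ren_fm (InC g) f = InC (ren_tm f g).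
Proof. unfold InC, Prefix. sim. reflexivity. Qed.

Lemma ren_Approx1 {G D} (f : renaming G D) a b :
  ren_fm (Approx1 a b) f = Approx1 (ren_tm f a) (ren_tm f b).
Proof. unfold Approx1. sim. reflexivity. Qed.

Lemma ren_SameValue {G D} (f : renaming G D) g a b :
  ren_fm (SameValue g a b) f = SameValue (ren_tm f g) (ren_tm f a) (ren_tm f b).
Proof. unfold SameValue, ValueIs. sim. reflexivity. Qed.

Lemma sub_InC {G D} (f : substitution G D) g : sub_fm (InC g) f = InC (sub_tm f g).
Proof. unfold InC, Prefix. sim. reflexivity. Qed.

Lemma sub_Approx1 {G D} (f : substitution G D) a b :
  sub_fm (Approx1 a b) f = Approx1 (sub_tm f a) (sub_tm f b).
Proof. unfold Approx1. sim. reflexivity. Qed.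

Lemma sub_SameValue {G D} (f : substitution G D) g a b :
  sub_fm (SameValue g a b) f = SameValue (sub_tm f g) (sub_tm f a) (sub_tm f b).
Proof. unfold SameValue, ValueIs. sim. reflexivity. Qed.

Lemma InC_nbhd {G} {H : list (fm G)} {g s t n} :
  prv H (InC g) -> E H s (take t n) -> prv H (zero ≺ g · s) -> E H (g · s) (g · t).
Proof.
  (* Truncating at the full length of [s] gives back [s], so positivity at [s] itself triggers the
     neighbourhood condition. *)
  intros c e p. apply prv_and2, (prv_inst s), (prv_inst t), (prv_inst (cLh · s)) in c.
  unfold Prefix in c. sim in c. apply E_intro, (prv_mp c), nd_andI.
  - apply nd_exI with (t := n). sim. exact e.
  - refine (pos_congr _ p). now rewrite take_eq, monus_diag, inits_zero.
Qed.

(** Of two initial segments of one function the shorter is a prefix of the longer, so the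
    neighbourhood condition applies in one direction or the other. *)
Lemma InC_seg {G} {H : list (fm G)} {g a k n} :
  prv H (InC g) -> prv H (zero ≺ g · seg a k) -> prv H (zero ≺ g · seg a n) ->
  E H (g · seg a n) (g · seg a k).
Proof.
  intros c p q. lecase n k as w e; [|symmetry].
  - apply (InC_nbhd (n := n) c); [|exact q]. now rewrite e, take_seg.
  - apply (InC_nbhd (n := k) c); [|exact p]. now rewrite e, take_seg.
Qed.

Lemma InC_value {G} {H : list (fm G)} {g a k} :
  prv H (InC g) -> prv H (zero ≺ g · seg a k) -> prv H (ValueIs g a (cPred · (g · seg a k))).
Proof.
  intros c p. apply (prv_all (InC g ∧ zero ≺ g · seg a k)); [now apply nd_andI|]. clear.
  intros H h. unfold wk_fm in h. cbn [ren_fm] in h. rewrite ren_InC in h. sim in h.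
  apply prv_imp. world H'. intros q. sim. as_E.
  rewrite <- (pos_E (prv_and2 h)). exact (InC_seg (prv_and1 h) (prv_and2 h) q).
Qed.

(** External induction is the right tool: the step uses [a n = b n], known for standard [n] only. *)
Lemma Approx1_seg {G} {H : list (fm G)} {a b k} :
  prv H (Approx1 a b) -> prv H (St k) -> E H (seg a k) (seg b k).
Proof.
  intros h s.
  pose proof (nd_ax P_ax G H _ (ax_ext_ind G (seg (wk a) #0 ≐ seg (wk b) #0))) as i.
  sim in i. assert (j : prv H (∀st[N] seg (wk a) #0 ≐ seg (wk b) #0)).
  - apply (prv_mp i), nd_andI; [as_E; now rewrite !seg_zero|]. clear i s.
    apply (prv_all _ h). clear. intros H h. unfold wk_fm in h. rewrite ren_Approx1 in h.
    apply prv_imp. world H'. intros s. apply prv_imp. world H''. intros IH.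
    apply (prv_inst #0) in h. sim in h. pose proof (E_intro (prv_mp h s)) as e.
    apply E_intro in IH. as_E. now rewrite !seg_Suc, IH, e.
  - apply (prv_inst k) in j. sim in j. exact (prv_mp j s).
Qed.

Lemma SameValue_st {G} {H : list (fm G)} {g a b k} :
  prv H (InC g) -> prv H (Approx1 a b) -> prv H (St k) -> prv H (zero ≺ g · seg a k) ->
  prv H (SameValue g a b).
Proof.
  intros c h s p. apply nd_exI with (t := cPred · (g · seg a k)).
  assert (e : E H (g · seg a k) (g · seg b k)) by now rewrite (Approx1_seg h s).
  unfold ValueIs. sim. apply nd_andI; [exact (InC_value c p)|].
  pose proof (InC_value c (pos_congr e p)) as q.
  apply (prv_all _ (prv_and q e)). clear. intros H h. unfold ValueIs in h. sim in h.
  apply prv_imp. world H'. intros p.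
  pose proof (E_intro (prv_and2 h)) as e. apply prv_and1, (prv_inst #0) in h. sim in h.
  pose proof (E_intro (prv_mp h p)) as d. as_E. now rewrite e.
Qed.

(** * Standardness and equations of the auxiliary terms *)

Lemma st_closed {G} {H : list (fm G)} {r} (c : forall G, tm G r) : closed_tm c -> prv H (St (c G)).
Proof.
  intros k.
  replace (c G) with (closed_in (G := G) (c [])) by apply closed_ren.
  apply nd_ax, ax_st_closed.
Qed.

Lemma st_cst {G} {H : list (fm G)} {r} (c : cst r) : prv H (St (Cst c)).
Proof. exact (nd_ax _ _ _ _ (ax_st_closed G r (Cst c))). Qed.

Lemma st_app {G} {H : list (fm G)} {r s} {f : tm G (r ⇒ s)} {t} :
  prv H (St f) -> prv H (St t) -> prv H (St (f · t)).
Proof.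
  intros a b. refine (prv_mp (nd_ax _ _ _ _ (ax_st_app _ _ _ f t)) _). now apply nd_andI.
Qed.

Section Terms.
Context {G : ctx} {H : list (fm G)}.

Lemma along_eq (g a : tm G (N ⇒ N)) n : E H (cAlong · g · a · n) (g · seg a n).
Proof. unfold cAlong. beta. sub_const. reflexivity. Qed.
Lemma stop_zero (f : tm G (N ⇒ N)) : E H (cStop · f · zero) zero.
Proof. unfold cStop. beta. apply E_R0. Qed.
Lemma stop_Suc (f : tm G (N ⇒ N)) n : E H (cStop · f · Suc n)
  (cIfz · (f · (cStop · f · n)) · Suc (cStop · f · n) · (cStop · f · n)).
Proof. unfold cStop. beta. rewrite E_RS. beta. sub_const. reflexivity. Qed.
#[local] Opaque cStop.
Lemma assoc_eq (f : tm G (N ⇒ N)) s : E H (cAssoc · f · s)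
  (cIfz · (f · (cStop · f · (cLh · s))) · zero · Suc (take s (cStop · f · (cLh · s)))).
Proof. unfold cAssoc. beta. sub_const. reflexivity. Qed.
Lemma tail_eq (f : tm G (N ⇒ N)) n : E H (cTail · f · n) (f · Suc n).
Proof. unfold cTail. beta. reflexivity. Qed.
Lemma const0_eq (n : tm G N) : E H (cConst0 · n) zero.
Proof. unfold cConst0. beta. reflexivity. Qed.
End Terms.
#[local] Opaque cAlong cStop cAssoc cTail cConst0.

(** Without a common value, [SameValue_st] forces [g] to vanish on all standard initial segments of
    [a]. Transfer extends this to all initial segments, contradicting totality of [g] at [a]. *)
Lemma TRANS_SameValue {G} {H : list (fm G)} {g a b : tm G (N ⇒ N)} :
  (prv H (∀st[N] cAlong · wk g · wk a · #0 ≐ zero) ->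
   prv H (∀[N] cAlong · wk g · wk a · #0 ≐ zero)) ->
  prv H (InC g) -> prv H (Approx1 a b) -> prv H (SameValue g a b ⊃ Bot) -> prv H Bot.
Proof.
  intros t c h n.
  assert (z : prv H (∀[N] cAlong · wk g · wk a · #0 ≐ zero)).
  { apply t. apply (prv_all (InC g ∧ Approx1 a b ∧ (SameValue g a b ⊃ Bot)));
      [exact (prv_and c (prv_and h n))|].
    clear. intros H h. unfold wk_fm in h. cbn [ren_fm] in h.
    rewrite ren_InC, ren_Approx1, ren_SameValue in h.
    apply prv_imp. world H'. intros s. as_E. rewrite along_eq.
    ncase (wk g · seg (wk a) #0) as y e; [exact e|].
    apply prv_bot, (prv_mp (prv_and2 (prv_and2 h))).
    exact (SameValue_st (prv_and1 h) (prv_and1 (prv_and2 h)) s (Suc_pos e)). }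
  apply prv_and1, (prv_inst a) in c. sim in c.
  apply (prv_ex _ c z). clear. intros H z p. sim in z.
  apply (prv_inst #0) in z. sim in z. apply E_intro in z. rewrite along_eq in z.
  apply pos_E in p. rewrite z in p. symmetry in p. exact (Suc_neq p).
Qed.

(** * Nonstandard continuity implies transfer *)

Lemma stop_stable {G} {H : list (fm G)} {f n} i {z} :
  E H (f · (cStop · f · n)) (Suc z) -> E H (cStop · f · (n + i)) (cStop · f · n).
Proof.
  intros h.
  pose proof (prv_ind_with (H := H) (f · (cStop · f · n) ≐ Suc z)
    (cStop · wk f · (wk n + #0) ≐ cStop · wk f · wk n) i) as k.
  sim in k. apply k; [exact I|exact h|as_E; now rewrite plus_zero|]. clear.
  intros H h IH. apply E_intro in h, IH. as_E.
  now rewrite plus_Suc, stop_Suc, IH, h, ifz_Suc.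
Qed.

Lemma stop_mono {G} {H : list (fm G)} {f x y z} :
  E H (f · (cStop · f · x)) (Suc z) -> E H (x - y) zero ->
  E H (cStop · f · y) (cStop · f · x).
Proof. intros h l. rewrite (le_wit _ _ l). exact (stop_stable _ h). Qed.

Lemma stop_le {G} {H : list (fm G)} f n : E H (cStop · f · n - n) zero.
Proof.
  induct (cStop · wk f · #0 - #0) zero n; [now rewrite stop_zero, monus_zero|].
  intros H' IH. rewrite stop_Suc. ncase (wk f · (cStop · wk f · #0)) as z e; rewrite e.
  - now rewrite ifz_zero, monus_Suc_Suc.
  - rewrite ifz_Suc. apply (le_trans _ _ _ IH), le_Suc.
Qed.

(** The search halts only at places where [f] is nonzero; if [f] vanishes at the current place,
    every step so far has advanced. *)
Lemma stop_id {G} {H : list (fm G)} f n :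
  E H (f · (cStop · f · n)) zero -> E H (cStop · f · n) n.
Proof.
  pose proof (prv_ind_with (H := H) (Bot ⊃ Bot)
    (wk f · (cStop · wk f · #0) ≐ zero ⊃ cStop · wk f · #0 ≐ #0) n) as k.
  sim in k. apply prv_mp, k; [cbn; auto|apply prv_true| |]; clear.
  - apply prv_imp. intros. apply stop_zero.
  - intros H _ IH. apply prv_imp. world H'. intros h. apply E_intro in h. as_E.
    ncase (wk f · (cStop · wk f · #0)) as z e.
    + pose proof (E_intro (prv_mp IH e)) as d. now rewrite stop_Suc, e, ifz_zero, d.
    + rewrite stop_Suc, e, ifz_Suc, e in h. exact (Suc_neq h).
Qed.

(** Otherwise the search would have arrived at [n] itself by [stop_id], and [f] would vanish
    there. *)
Lemma stop_hit {G} {H : list (fm G)} {f n z} :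
  E H (f · n) (Suc z) ->
  E H (f · (cStop · f · n)) (Suc (cPred · (f · (cStop · f · n)))).
Proof.
  intros h. ncase (f · (cStop · f · n)) as y e.
  - rewrite (stop_id _ _ e), h in e. exact (Suc_neq e).
  - now rewrite e, pred_Suc.
Qed.

Lemma assoc_Suc {G} {H : list (fm G)} {f s z} :
  E H (f · (cStop · f · (cLh · s))) (Suc z) ->
  E H (cAssoc · f · s) (Suc (take s (cStop · f · (cLh · s)))).
Proof. intros h. now rewrite assoc_eq, h, ifz_Suc. Qed.

(** Counting removals: if [s] arises from [t] by removing [j] entries, cutting [t] down to [m]
    entries removes those [j] and then as many as cutting [s] does, because [m] is at most the
    length of [s]. *)
Lemma take_take {G} {H : list (fm G)} {s t m n : tm G N} :
  E H s (take t n) -> E H (m - cLh · s) zero -> E H (take s m) (take t m).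
Proof.
  rewrite (take_eq t n). pose proof (monus_le (H := H) (cLh · t) n) as l. revert l.
  generalize (cLh · t - n). intros j l e h.
  assert (e' : E H (cLh · t) (j + cLh · s)).
  { rewrite e, lh_inits. exact (le_wit _ _ l). }
  apply le_wit in h.
  assert (q : E H (cLh · t - m) (j + (cLh · s - m))).
  { rewrite e', h at 1. rewrite plus_assoc, (plus_comm j), <- plus_assoc. apply plus_monus_l. }
  rewrite (take_eq t m), q, <- inits_plus, <- e. apply take_eq.
Qed.

Lemma lh_take_le {G} {H : list (fm G)} s n : E H (cLh · take s n - cLh · s) zero.
Proof. rewrite take_eq, lh_inits. apply monus_le. Qed.

(** A positive value at the truncation of [s] means that the search succeeds within its length. It
    then stops at the same place for [s] and for [t], and [take_take] identifies the two answers. *)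
Lemma assoc_nbhd {G} {H : list (fm G)} {f s t n n'} :
  E H s (take t n') -> prv H (zero ≺ cAssoc · f · take s n) ->
  E H (cAssoc · f · s) (cAssoc · f · t).
Proof.
  intros e p. ncase (f · (cStop · f · (cLh · take s n))) as z h.
  - apply pos_E in p. rewrite assoc_eq, h, ifz_zero in p. symmetry in p. exact (Suc_neq p).
  - pose proof (stop_mono h (lh_take_le s n)) as h1.
    assert (h' : E H0 (f · (cStop · f · (cLh · s))) (Suc z)) by now rewrite h1.
    assert (l : E H0 (cLh · s - cLh · t) zero) by (rewrite e; apply lh_take_le).
    pose proof (stop_mono h' l) as h2.
    rewrite (assoc_Suc h'), (assoc_Suc (s := t) (z := z)) by now rewrite h2.
    now rewrite h2, (take_take e (stop_le _ _)).
Qed.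

Lemma assoc_seg {G} {H : list (fm G)} {f m z} a :
  E H (f · m) (Suc z) -> E H (cAssoc · f · seg a m) (Suc (seg a (cStop · f · m))).
Proof.
  intros h. rewrite (assoc_Suc (z := cPred · (f · (cStop · f · m)))), lh_seg.
  (* The length [m] is split into the stopping place and a remainder, the shape that [take_seg]
     needs. *)
  - rewrite (le_wit _ _ (stop_le f m)) at 1. now rewrite take_seg.
  - rewrite lh_seg. exact (stop_hit h).
Qed.

(** The same [m], possibly nonstandard, is a sufficient length for every argument, which gives
    totality. *)
Lemma assoc_InC {G} {H : list (fm G)} {f m z} :
  E H (f · m) (Suc z) -> prv H (InC (cAssoc · f)).
Proof.
  intros h. apply nd_andI.
  - apply (prv_all (f · m ≐ Suc z) h). clear. intros H h. sim in h.
    apply nd_exI with (t := wk m). sim. exact (Suc_pos (assoc_seg _ h)).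
  - unfold Prefix. sim. apply nd_allI, nd_allI, nd_allI, prv_imp. world H'. intros k.
    refine (prv_ex _ (prv_and1 k) (prv_and2 k) _). clear. intros H p e. sim in p. sim in e.
    sim. exact (assoc_nbhd e p).
Qed.

(** The last entry is recovered from the code as the second component of the pairing. *)
Lemma seg_Suc_inj {G} {H : list (fm G)} {a b : tm G (N ⇒ N)} {n} :
  E H (seg a (Suc n)) (seg b (Suc n)) -> E H (a · n) (b · n).
Proof.
  rewrite !seg_Suc. intros h. apply Suc_inj in h.
  rewrite <- (snd_pair (seg a n) (a · n)), h. apply snd_pair.
Qed.

(** A common value would identify the segments of length [μ], the stopping place. Since [f] vanishes
    at zero, [μ] is a successor, and the last entries are [0] and [f μ], which differ. *)
Lemma assoc_separates {G} {H : list (fm G)} {f m z} :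
  E H (f · zero) zero -> E H (f · m) (Suc z) ->
  prv H (SameValue (cAssoc · f) cConst0 (cTail · f)) -> prv H Bot.
Proof.
  intros f0 h v. apply (prv_ex (f · zero ≐ zero ∧ f · m ≐ Suc z) v (prv_and f0 h)). clear.
  intros H k v. sim in k. sim in v.
  pose proof (E_intro (prv_and1 k)) as f0. pose proof (E_intro (prv_and2 k)) as h.
  pose proof (prv_inst (wk m) (prv_and1 v)) as va. pose proof (prv_inst (wk m) (prv_and2 v)) as vb.
  sim in va. sim in vb.
  pose proof (E_intro (prv_mp va (Suc_pos (assoc_seg _ h)))) as ea.
  pose proof (E_intro (prv_mp vb (Suc_pos (assoc_seg _ h)))) as eb.
  rewrite (assoc_seg _ h) in ea. rewrite (assoc_seg _ h) in eb. rewrite <- eb in ea. apply Suc_inj in ea.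
  pose proof (stop_hit h) as s. clear - f0 ea s. change (prv H Bot).
  revert ea s. generalize (cStop · wk f · wk m : tm (N :: G) N). intros n ea s.
  apply (nat_case n).
  - world H'. intros e. rewrite e, f0 in s. symmetry in s. exact (Suc_neq s).
  - intros H' y i e; lift i. rewrite e in ea, s. apply seg_Suc_inj in ea.
    rewrite const0_eq, tail_eq, s in ea. symmetry in ea. exact (Suc_neq ea).
Qed.

(** * The two implications *)

Lemma TRANS_NPC : P_proves (Pi01_TRANS ⊃ NPCa).
Proof.
  apply nd_impI. unfold NPCa.
  apply nd_allI, nd_impI, nd_impI, nd_allI, nd_impI, nd_allI, nd_impI. cbn [map].
  (* The hypotheses are extracted and their concrete list is then generalised, so that the remaining
     argument treats it as a variable. *)
  match goal with |- nd _ _ ?H _ =>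
    assert (t : prv H (wk_fm (wk_fm (wk_fm Pi01_TRANS)))) by (apply nd_hyp; cbn; auto 10);
    assert (sg : prv H (wk_fm (wk_fm (St #0)))) by (apply nd_hyp; cbn; auto 10);
    assert (c : prv H (wk_fm (wk_fm (InC #0)))) by (apply nd_hyp; cbn; auto 10);
    assert (sa : prv H (wk_fm (St #0))) by (apply nd_hyp; cbn; auto 10);
    assert (h : prv H (Approx1 #1 #0)) by (apply nd_hyp; cbn; auto 10);
    revert t sg c sa h; generalize H
  end.
  intros H t sg c sa h. unfold wk_fm in c. rewrite !ren_InC in c.
  unfold Pi01_TRANS in t. sim in t. sim in sg. sim in sa. sim in c.
  apply prv_raa. world H'. intros n.
  refine (TRANS_SameValue _ c h n). intros z.
  apply (prv_inst (cAlong · #2 · #1)) in t. sim in t.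
  apply (fun k => prv_mp (prv_mp t k) z).
  exact (st_app (st_app (st_closed (@cAlong) _) sg) sa).
Qed.

Lemma NPC_TRANS : P_proves (NPCa ⊃ Pi01_TRANS).
Proof.
  apply nd_impI. unfold Pi01_TRANS.
  apply nd_allI, nd_impI, nd_impI, nd_allI. cbn [map].
  match goal with |- nd _ _ ?H _ =>
    assert (t : prv H (wk_fm (wk_fm NPCa))) by (apply nd_hyp; cbn; auto 10);
    assert (s : prv H (wk_fm (St #0))) by (apply nd_hyp; cbn; auto 10);
    assert (z : prv H (wk_fm (∀st[N] #1 · #0 ≐ zero))) by (apply nd_hyp; cbn; auto 10);
    revert t s z; generalize H
  end.
  intros H t s z. sim in s. sim in z. as_E. ncase (#1 · #0) as y h; [exact h|].
  (* Zero is standard, so the counterexample [#0] cannot be zero; this keeps the last entry before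
     [μ] available. *)
  assert (f0 : E H0 (#1 · zero) zero).
  { apply (prv_inst zero) in z. sim in z. exact (prv_mp z (st_cst cO)). }
  apply prv_bot, (assoc_separates f0 h).
  unfold wk_fm, NPCa in t. cbn [ren_fm] in t. rewrite !ren_InC, !ren_Approx1, !ren_SameValue in t.
  (* Standardness of this associate depends on [f] alone; the counterexample [m] enters only in the
     derivation of membership in [C]. *)
  apply (prv_inst (cAssoc · #1)) in t. unfold inst in t. cbn [sub_fm] in t.
  rewrite sub_InC, sub_Approx1, sub_SameValue in t. sim in t.
  assert (sg : prv H0 (St (cAssoc · #1))) by exact (st_app (st_closed (@cAssoc) _) s).
  apply (fun t => prv_mp (prv_mp t sg) (assoc_InC h)) in t.
  apply (prv_inst cConst0) in t. unfold inst in t. cbn [sub_fm] in t.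
  rewrite sub_Approx1, sub_SameValue in t. sim in t.
  apply (fun t => prv_mp t (st_closed (@cConst0) _)) in t.
  apply (prv_inst (cTail · #1)) in t. unfold inst in t. cbn [sub_fm] in t.
  rewrite sub_Approx1, sub_SameValue in t. sim in t.
  (* The two arguments agree at standard [n] because [S n] is again standard, so [f (S n)]
     vanishes. *)
  apply (prv_mp t). apply (prv_all _ z). clear. intros H z. sim in z. sim.
  apply prv_imp. world H'. intros s. as_E. rewrite const0_eq, tail_eq. symmetry.
  apply (prv_inst (Suc #0)) in z. sim in z. apply (prv_mp z).
  exact (st_app (st_cst cS) s).
Qed.

Theorem theorem4p21 : P_proves (Iff NPCa Pi01_TRANS).
Proof. exact (prv_and NPC_TRANS TRANS_NPC). Qed.
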